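(* Let $G$ be an acylindrically hyperbolic group, let $k\ge 1$, and let $w\in\mathbb{F}_k$ be a non-trivial element with $d(w)=0$. Then there exists an element $g\in w(G)$ with $svl_w(g)>0$.
   Context: $\mathbb{F}_k$ is the free group on $x_1,\dots,x_k$. For a group $G$ and $w\in\mathbb{F}_k$, substitution of group elements for the $x_i$ gives a map $w:G^k\to G$. Its image is denoted $w[G]$ (the verbal subset), and $w(G)<G$ is the subgroup generated by $w[G]$ (the verbal subgroup). Let $e_i$ be the sum of the exponents of $x_i$ in $w$. If not all $e_i$ are $0$, $d(w)\ge 1$ is the greatest common divisor of $e_1,\dots,e_k$; if all $e_i=0$, $d(w)=0$. For $g\in w(G)$ the verbal length is $vl_w(g)=\min\{n \mid g=g_1\cdots g_n,\ g_i\in w[G]^{\pm1}\}$, where $w[G]^{\pm 1}$ is the set of elements of $w[G]$ and their inverses. The stable verbal length of $g\in w(G)$ is $svl_w(g)=\liminf_{n\to\infty}\frac{vl_w(g^n)}{n}$. An isometric action of $G$ on a metric space $X$ is acylindrical if for all $D>0$ there exist $L,N>0$ such that whenever $d(x,y)>L$ the set $\{g\in G \mid d(x,gx)<D \text{ and } d(y,gy)<D\}$ has fewer than $N$ elements. A group $G$ is acylindrically hyperbolic if it has a non-elementary acylindrical isometric action on a $\delta$-hyperbolic (geodesic) space; non-elementary means that the limit set of $G$ in the Gromov boundary has more than two points. *)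

(* Defs.v *)
From HB Require Import structures.
From mathcomp Require Import all_boot all_order all_algebra.
From mathcomp Require Import all_classical all_reals all_analysis.

Set Implicit Arguments.
Unset Strict Implicit.
Unset Printing Implicit Defensive.

Import Order.TTheory GRing.Theory Num.Theory.

Local Open Scope classical_set_scope.
Local Open Scope ring_scope.

(* The letter (i, false) stands for x_i, and (i, true) for its inverse. *)
Notation letter k := ('I_k * bool)%type (only parsing).

Definition linv k (a : letter k) : letter k := (a.1, ~~ a.2).

Definition reduced k (s : seq (letter k)) : bool :=
  sorted (fun a b : letter k => b != linv a) s.

Record freegroup (k : nat) := FreeGroup {
  fgword :> seq (letter k);
  fgwordP : reduced fgword
}.

HB.instance Definition _ k := [isSub for @fgword k].
HB.instance Definition _ k := [Choice of freegroup k by <:].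

Section FreeGroupStructure.
Variable k : nat.
Implicit Types (a b : letter k) (s t : seq (letter k)) (u v w : freegroup k).

Definition cons_letter a s :=
  if s is b :: s' then if b == linv a then s' else a :: s else [:: a].

Definition rmul s t := foldr cons_letter t s.

Definition rinv s := rev (map (@linv k) s).

Lemma linvK : involutive (@linv k).
Proof. by case=> i b; rewrite /linv /= negbK. Qed.

Lemma reduced_behead a s : reduced (a :: s) -> reduced s.
Proof. by case: s => //= b s /andP[]. Qed.

Lemma cons_letter_cons a s : reduced (a :: s) -> cons_letter a s = a :: s.
Proof. by case: s => //= b s /andP[/negbTE->]. Qed.

Lemma reduced_cons_letter a s : reduced s -> reduced (cons_letter a s).
Proof.
case: s => //= b s; case: eqP => [_ /(@reduced_behead b)//|/eqP ba rs].
by rewrite /= ba.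
Qed.

Lemma cons_letterK a s :
  reduced s -> cons_letter a (cons_letter (linv a) s) = s.
Proof.
case: s => [|b s] /=; first by rewrite eqxx.
rewrite linvK; case: eqP => [-> rs|_ _]; first exact: cons_letter_cons.
by rewrite /= eqxx.
Qed.

Lemma reduced_rmul s t : reduced t -> reduced (rmul s t).
Proof. by elim: s => //= a s IH rt; apply/reduced_cons_letter/IH. Qed.

Lemma rmul_cons_letter a s t : reduced t ->
  rmul (cons_letter a s) t = cons_letter a (rmul s t).
Proof.
case: s => //= b s rt; case: eqP => [->|//].
by rewrite cons_letterK// reduced_rmul.
Qed.

Lemma rmulA s t r : reduced r -> rmul s (rmul t r) = rmul (rmul s t) r.
Proof. by move=> rr; elim: s => //= a s ->; rewrite rmul_cons_letter. Qed.

Lemma rmuls0 s : reduced s -> rmul s [::] = s.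
Proof.
elim: s => //= a s IH rs.
by rewrite IH ?cons_letter_cons//; apply: reduced_behead rs.
Qed.

Lemma reduced_rinv s : reduced s -> reduced (rinv s).
Proof.
rewrite /reduced /rinv rev_sorted sorted_map; apply: sub_sorted => a b /=.
by apply: contraNneq => ->; rewrite !linvK.
Qed.

Lemma rmul_cat s t r : rmul (s ++ t) r = rmul s (rmul t r).
Proof. exact: foldr_cat. Qed.

Lemma rmulKV s t : reduced t -> rmul s (rmul (rinv s) t) = t.
Proof.
elim: s t => //= a s IH t rt.
rewrite /rinv map_cons rev_cons -cats1 rmul_cat /= IH ?reduced_cons_letter//.
exact: cons_letterK.
Qed.

Lemma rinvK : involutive rinv.
Proof.
by move=> s; rewrite /rinv map_rev revK -map_comp map_id_in// => a _; exact: linvK.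
Qed.

Definition fgone := @FreeGroup k [::] isT.
Definition fgmul u v := FreeGroup (reduced_rmul u (fgwordP v)).
Definition fginv u := FreeGroup (reduced_rinv (fgwordP u)).

Fact fgmulA : associative fgmul.
Proof. by move=> u v w; apply/val_inj/rmulA/fgwordP. Qed.

Fact fgmul1g : left_id fgone fgmul.
Proof. by move=> u; apply/val_inj. Qed.

Fact fgmulg1 : right_id fgone fgmul.
Proof. by move=> u; apply/val_inj/rmuls0/fgwordP. Qed.

Fact fgmulgV : right_inverse fgone fginv fgmul.
Proof.
move=> u; apply/val_inj => /=.
by rewrite -[rinv u]rmuls0 ?rmulKV// reduced_rinv ?fgwordP.
Qed.

Fact fgmulVg : left_inverse fgone fginv fgmul.
Proof.
move=> u; have {2}-> : u = fginv (fginv u) by apply/val_inj; rewrite /= rinvK.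
exact: fgmulgV.
Qed.

HB.instance Definition _ :=
  isGroup.Build (freegroup k) fgmulA fgmul1g fgmulg1 fgmulVg fgmulgV.

Definition fggen (i : 'I_k) : freegroup k := @FreeGroup k [:: (i, false)] isT.

End FreeGroupStructure.

Section WordMap.
Variables (G : groupType) (k : nat).
Implicit Types (v : 'I_k -> G) (w : freegroup k).

Definition letter_eval v (a : letter k) : G :=
  if a.2 then ((v a.1)^-1)%g else v a.1.

(* Substitution of v i for x_i. *)
Definition word_eval v w : G := (\prod_(a <- (w : seq (letter k))) letter_eval v a)%g.

Lemma word_eval_gen v i : word_eval v (fggen i) = v i.
Proof. by rewrite /word_eval big_seq1. Qed.

Lemma word_evalM v : {morph word_eval v : w1 w2 / (w1 * w2)%g >-> (w1 * w2)%g}.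
Proof.
have rcE a s : (\prod_(b <- cons_letter a s) letter_eval v b =
    letter_eval v a * \prod_(b <- s) letter_eval v b)%g.
  case: s => [|b s] /=; first by rewrite big_seq1 big_nil mulg1.
  case: eqP => [->|_]; last by rewrite !big_cons.
  have aV : (letter_eval v a * letter_eval v (linv a) = 1)%g.
    by rewrite /letter_eval /=; case: a.2; rewrite ?mulVg ?mulgV.
  by rewrite big_cons mulgA aV mul1g.
move=> w1 w2; rewrite /word_eval /=.
elim: (fgword w1) => [|a s IH] /=; first by rewrite big_nil mul1g.
by rewrite rcE IH big_cons mulgA.
Qed.

Definition verbal_subset w : set G := range (fun v : 'I_k -> G => word_eval v w).

Definition verbal_subgroup w : set G :=
  smallest (fun H : set G => group_closed (mem H)) (verbal_subset w).

Definition verbal_subset_pm w : set G :=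
  verbal_subset w `|` [set (x^-1)%g | x in verbal_subset w].

Definition verbal_product w (g : G) (n : nat) : Prop :=
  exists2 s : n.-tuple G, (forall x, x \in s -> verbal_subset_pm w x) &
    g = (\prod_(x <- s) x)%g.

(* Least n with verbal_product w g n; the value outside verbal_subgroup w,
   where there is no such n, is 0 by convention. *)
Definition verbal_length w (g : G) : nat :=
  xget 0%N [set n | verbal_product w g n /\
                    forall m, verbal_product w g m -> (n <= m)%N].

Definition stable_verbal_length (R : realType) w (g : G) : \bar R :=
  limn_einf (fun n => ((verbal_length w (g ^+ n)%g)%:R / n%:R)%:E).

End WordMap.

Definition exponent_sum k (w : freegroup k) (i : 'I_k) : int :=
  \sum_(a <- (w : seq (letter k)) | a.1 == i) (if a.2 then -1 else 1).

(* As gcdn 0 0 = 0, this is 0 when all the exponent sums are 0. *)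
Definition exponent_gcd k (w : freegroup k) : nat :=
  \big[gcdn/0%N]_(i < k) `|exponent_sum w i|%N.

Section Hyperbolic.
Variables (R : realType) (X : metricType R).
Implicit Types (x y z o : X) (S : set X).

Definition geodesic_segment x y S : Prop :=
  exists c : R -> X,
    [/\ c 0 = x, c (mdist x y) = y,
        {in `[0, mdist x y] &, forall s t, mdist (c s) (c t) = `|s - t|} &
        S = c @` `[0, mdist x y]].

Definition geodesic_space : Prop :=
  forall x y, exists S, geodesic_segment x y S.

(* Geodesic triangles are delta-slim; permuting the vertices gives the
   condition for the other two sides. *)
Definition slim_triangles (delta : R) : Prop :=
  forall x y z Sxy Syz Sxz,
    geodesic_segment x y Sxy -> geodesic_segment y z Syz ->
    geodesic_segment x z Sxz ->
    forall p, Sxy p -> exists2 q, (Syz `|` Sxz) q & mdist p q <= delta.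

Definition hyperbolic_space : Prop :=
  geodesic_space /\ exists2 delta : R, 0 <= delta & slim_triangles delta.

Definition gromov_product o x y : R :=
  (mdist o x + mdist o y - mdist x y) / 2.

Definition gromov_asymptotic o (u v : nat -> X) : Prop :=
  forall M : R, exists N : nat, forall i j, (N <= i)%N -> (N <= j)%N ->
    M <= gromov_product o (u i) (v j).

Definition converges_at_infinity o (u : nat -> X) : Prop :=
  gromov_asymptotic o u u.

Definition boundary_class o (u : nat -> X) : set (nat -> X) :=
  [set v | converges_at_infinity o v /\ gromov_asymptotic o u v].

(* Boundary points are classes of sequences. In a hyperbolic space
   gromov_asymptotic is an equivalence on the sequences that converge at
   infinity, and it does not depend on the base point o. *)
Definition gromov_boundary o : set (set (nat -> X)) :=
  [set boundary_class o u | u in converges_at_infinity o].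

End Hyperbolic.

Section Actions.
Variables (R : realType) (G : groupType) (X : metricType R).
Implicit Types act : G -> X -> X.

Definition isometric_action act : Prop :=
  [/\ forall x, act 1%g x = x,
      forall g h x, act (g * h)%g x = act g (act h x) &
      forall g x y, mdist (act g x) (act g y) = mdist x y].

Definition acylindrical act : Prop :=
  forall D : R, 0 < D -> exists (L : R) (N : nat), [/\ 0 < L, (0 < N)%N &
    forall x y, L < mdist x y ->
      exists2 n, (n < N)%N &
        ([set g | mdist x (act g x) < D /\ mdist y (act g y) < D]
          #= `I_n)%card].

(* A sequence of X converges to the boundary point xi iff it belongs to the
   class xi. *)
Definition limit_set act (o : X) : set (set (nat -> X)) :=
  [set xi | gromov_boundary o xi /\
            exists g : nat -> G, xi (fun n => act (g n) o)].

Definition nonelementary act : Prop :=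
  exists o : X, exists xi1 xi2 xi3,
    [/\ limit_set act o xi1, limit_set act o xi2 & limit_set act o xi3] /\
    [/\ xi1 <> xi2, xi1 <> xi3 & xi2 <> xi3].

End Actions.

Definition acylindrically_hyperbolic (R : realType) (G : groupType) : Prop :=
  exists (X : metricType R) (act : G -> X -> X),
    [/\ hyperbolic_space X, isometric_action act, acylindrical act &
        nonelementary act].

(* Main.v *)
Require Import Defs.
From HB Require Import structures.
From mathcomp Require Import all_boot all_order all_algebra.
From mathcomp Require Import all_classical all_reals all_analysis.
From mathcomp Require Import zify ring lra.

(* Fix a base point o.  For an element sigma, let rho (x, y) be the least length
   of a path from x to y that may use the translates of the jump from o to
   sigma o, each at a discount W.  If sigma is long compared with W, the optimal
   paths are broken geodesics with long edges and small backtracking, so they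
   pass near the points of the geodesic [x, y], and
     phi (g) = rho (g o, o) - rho (o, g o)
   is a quasimorphism with phi (g^-1) = - phi (g).  When all exponent sums of w
   vanish, phi is bounded on w[G], so that a linear lower bound on phi (g^n)
   for some g in w(G) gives svl_w (g) > 0.

   A ping-pong argument gives a loxodromic u that is a product of two values of
   w.  By acylindricity u has conjugates u_0, u_1, u_2 whose axes pairwise have
   bounded overlap.  With sigma = u_0^n0 u_1^n1 and g = sigma u_2^n2, where
   n2 << n0 << n1, the path from o to g^n o saves W on each period.  A translate
   of sigma cannot travel along the axis of g backwards, because the lengths of
   the syllables would appear in the wrong cyclic order; hence the path from
   g^n o to o saves nothing, and phi (g^n) grows linearly. *)

(** The constants threaten to be circular: [W] has to exceed the length lost at the corners of g^n,
    the errors in the overlap arguments grow with [W], and the syllables have to be long compared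
    with these errors. The circle is broken by a corner bound that does not depend on the exponents
    n_i: rays along two translates of the axis diverge whatever their lengths, unless the
    translating elements lie in the same coset of the commensurator of u. The corner bound thus
    determines [W], [W] the overlap errors, and these the exponents.

    Acylindricity enters as a pigeonhole principle: a long overlap of the axis with its translate by
    f makes two elements coincide, and their equality says that f conjugates a nonzero power of u to
    a nonzero power. No geodesic axis is constructed; the orbit of the powers of u takes its place,
    and nearness to a geodesic [x, y] is expressed by a small [excess]. *)

Set Implicit Arguments.
Unset Strict Implicit.
Unset Printing Implicit Defensive.

Import Order.TTheory GRing.Theory Num.Theory.

Local Open Scope classical_set_scope.
Local Open Scope ring_scope.

(** * Four-point hyperbolicity *)

(* Twice the Gromov product of [x] and [y] based at [z]. *)
Definition excess (R : realType) (X : metricType R) (x z y : X) : R :=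
  mdist x z + mdist z y - mdist x y.

(** A symmetric form of the inequality between three Gromov products. As [excess] doubles the
    product, [dl] is twice the usual constant. *)
Definition four_point (R : realType) (X : metricType R) (dl : R) : Prop :=
  forall x y z t : X,
    mdist x z + mdist y t <= mdist x y + mdist z t + dl \/
    mdist x z + mdist y t <= mdist x t + mdist y z + dl.

Lemma mdist_via (R : realType) (X : metricType R) (z x y : X) :
  mdist x y <= mdist x z + mdist z y.
Proof. exact: metric_triangle. Qed.

Lemma nat_switch (P : nat -> Prop) M : P 0%N -> ~ P M ->
  exists i, [/\ (i < M)%N, P i & ~ P i.+1].
Proof.
elim: M => [//|M IH] P0 nPM.
have [PM|nP] := pselect (P M); first by exists M.
by have [i [iM Pi nPi]] := IH P0 nP; exists i; split => //; apply: ltnW.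
Qed.

Section FourPoint.
Variables (R : realType) (X : metricType R) (dl : R).
Hypotheses (dl0 : 0 <= dl) (fp : four_point X dl).
Local Notation d := (@mdist R X).
Local Notation exc := (@excess R X).
Implicit Types x y z m : X.

Lemma excess_ge0 x z y : 0 <= exc x z y.
Proof. by have := mdist_via z x y; rewrite /excess; lra. Qed.

Lemma excess_sym x z y : exc x z y = exc y z x.
Proof.
rewrite /excess (metric_sym y z) (metric_sym y x) (metric_sym z x); lra.
Qed.

Lemma excess_left x y : exc x x y = 0.
Proof. by rewrite /excess mdistxx; lra. Qed.

Lemma excess_right x y : exc x y y = 0.
Proof. by rewrite /excess mdistxx; lra. Qed.

Lemma excess_center x y z z' : exc x z' y <= exc x z y + 2 * d z z'.
Proof.
have := mdist_via z x z'; have := mdist_via z z' y.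
by rewrite /excess (metric_sym z' z); lra.
Qed.

Lemma excess_end x z y y' : exc x z y' <= exc x z y + 2 * d y y'.
Proof.
have := mdist_via y z y'; have := mdist_via y' x y.
by rewrite /excess (metric_sym y' y); lra.
Qed.

Lemma excess_endl x x' z y : exc x' z y <= exc x z y + 2 * d x x'.
Proof. by rewrite ![exc _ z y]excess_sym excess_end. Qed.

Lemma excess_min a b c p :
  exc a b c <= exc p b c + dl \/ exc a b p <= exc p b c + dl.
Proof.
have := fp p a c b; rewrite /excess (metric_sym p a) (metric_sym b p).
by rewrite (metric_sym c b) => -[] ?; [right|left]; lra.
Qed.

(** Points close to [x, y] are determined, up to a bounded error, by their distance from [x]. This
    takes over the role of nearest-point projections. *)
Lemma excess_near x y z z' c e : exc x z y <= c -> exc x z' y <= c ->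
  `|d x z - d x z'| <= e -> d z z' <= e + c + dl.
Proof.
rewrite /excess ler_norml => h1 h2 /andP[h3 h4].
have := metric_sym z y; have := metric_sym z' y.
by case: (fp x z y z'); rewrite ?(metric_sym y z'); lra.
Qed.

Lemma excess_convex x y p q z c K : exc x p y <= c -> exc x q y <= c ->
  exc p z q <= K -> exc x z y <= K + c + dl.
Proof.
move=> hp hq; rewrite excess_sym.
have far r : exc x r y <= c -> exc x z y - c <= exc x z r.
  have := mdist_via r z y; rewrite /excess (metric_sym z r); lra.
have := far _ hp; have := far _ hq.
by case: (excess_min x z p q); lra.
Qed.

(** The geodesics from [o] to [x] and to [y] fellow-travel up to the Gromov product of [x] and [y],
    and [z] lies on this common stretch. *)
Lemma excess_fellow o x y z c e b : exc o z x <= c ->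
  2 * d o z <= exc x o y + e -> c <= b -> e <= b -> exc o z y <= b + dl.
Proof.
rewrite /excess => h1 h2 cb eb; have := metric_sym x o; have := metric_sym z o.
have := metric_sym y x; have := metric_sym z x; by case: (fp z o y x); lra.
Qed.

Section BrokenGeodesic.
Variables (t : nat -> X) (M : nat) (C L : R).
Hypotheses (hL : forall i, (i.+1 < M)%N -> L <= d (t i) (t i.+1))
  (hC : forall i, (i.+1 < M)%N -> exc (t i) (t i.+1) (t i.+2) <= C)
  (C0 : 0 <= C) (LC : 2 * C + 3 * dl < 2 * L).

(** If the bound failed at the next corner, the four-point inequality would bound the backtracking
    along the last edge by C + dl; but by induction that edge moves away from [t i], so it is
    retraced almost fully, by at least 2L - (C + dl). *)
Lemma broken_forward i j : (i <= j)%N -> (j < M)%N ->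
  exc (t i) (t j) (t j.+1) <= C + dl.
Proof.
have dl0' := dl0; have C0' := C0; have LC' := LC.
move=> /subnK <-; elim: (j - i)%N => [|n IH] jM.
  by rewrite add0n excess_left; lra.
have {}IH := IH (ltnW jM); have := hL jM; have := hC jM.
rewrite addSn; set k := (n + i)%N in IH *.
case: (excess_min (t i) (t k.+1) (t k.+2) (t k)) => [|h]; first lra.
move: IH h; rewrite /excess (metric_sym (t k.+1) (t k)); lra.
Qed.

Lemma broken_backward j k : (j < k)%N -> (k <= M)%N ->
  exc (t j) (t j.+1) (t k) <= C + dl.
Proof.
have dl0' := dl0; have C0' := C0; have LC' := LC.
move=> /subnK <-; move: (k - j.+1)%N => n; elim: n j => {k} [|n IH] j kM.
  by rewrite add0n excess_right; lra.
rewrite addSnnS in kM *; have {IH} := IH j.+1 kM.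
move: kM; set k := (n + j.+2)%N => kM IH.
have jk : (j.+2 <= k)%N by rewrite leq_addl.
have hC1 := hC (leq_trans jk kM).
move: jk; rewrite leq_eqVlt => /predU1P[<-|jk]; first by lra.
have jM2 := leq_trans jk kM.
have hL1 := hL jM2.
case: (excess_min (t k) (t j.+1) (t j) (t j.+2)).
- by rewrite (excess_sym (t k)) (excess_sym (t j.+2)); lra.
- rewrite (excess_sym (t j.+2)) => h; move: hC1 IH hL1 h.
  rewrite /excess (metric_sym (t k) (t j.+2)) (metric_sym (t k) (t j.+1)).
  by lra.
Qed.

(** The two one-sided bounds are glued along the edge from [t j] to [t j.+1]. The case to exclude
    would give 2L <= 2C + 3dl, whence the form of [LC]. *)
Lemma broken_middle i j k : (i <= j)%N -> (j <= k)%N -> (k <= M)%N ->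
  exc (t i) (t j) (t k) <= C + 2 * dl.
Proof.
have dl0' := dl0; have C0' := C0; have LC' := LC.
move=> ij; rewrite leq_eqVlt => /predU1P[->|jk] kM.
  by rewrite excess_right; lra.
have := broken_forward ij (leq_trans jk kM).
have := broken_backward jk kM.
move: jk; rewrite leq_eqVlt => /predU1P[<-|jk]; first by lra.
have := hL (leq_trans jk kM).
case: (excess_min (t k) (t j) (t i) (t j.+1)).
  by rewrite (excess_sym (t k)) (excess_sym (t j.+1)); lra.
rewrite (excess_sym (t j.+1)) /excess (metric_sym (t k) (t j.+1)).
by rewrite (metric_sym (t k) (t j)); lra.
Qed.

End BrokenGeodesic.

(** A vertex that lies before [m] and whose successor does not: by the four-point inequality the
    successor then lies after [m], so the edge between them passes near [m]. *)
Lemma excess_path_edge (t : nat -> X) M K c m : (0 < M)%N ->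
  (forall j, (j <= M)%N -> exc (t 0%N) (t j) (t M) <= K) ->
  0 <= K -> exc (t 0%N) m (t M) <= c ->
  exists2 i, (i < M)%N & exc (t i) m (t i.+1) <= c + 2 * (K + dl).
Proof.
move=> M0 hK K0 hm; have dl0' := dl0.
have [] := @nat_switch (fun i => exc (t 0%N) (t i) m <= K + dl /\ (i < M)%N) M.
- by split=> //; rewrite excess_left; lra.
- by case; rewrite ltnn.
move=> i [iM [Pi _] nPi]; exists i => //.
have Qi : exc m (t i.+1) (t M) <= K + dl.
  case: (ltnP i.+1 M) => [iM1|Mi]; last first.
    have -> : i.+1 = M by apply/eqP; rewrite eqn_leq iM.
    by rewrite excess_right; lra.
  have := hK _ (ltnW iM1).
  case: (excess_min m (t i.+1) (t M) (t 0%N)); first by lra.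
  rewrite (excess_sym m) => h1 h2; exfalso; apply: nPi; split => //; lra.
have := mdist_via (t i) (t 0%N) (t M).
have := mdist_via (t i.+1) (t i) (t M).
move: Pi Qi hm; rewrite /excess; lra.
Qed.

End FourPoint.

(** * From slim triangles to the four-point inequality *)

Section SlimTriangles.
Variables (R : realType) (X : metricType R).
Implicit Types (x y z o p : X) (S : set X).
Local Notation d := (@mdist R X).

Lemma geodesic_split x y S p : geodesic_segment x y S -> S p ->
  d x y = d x p + d p y.
Proof.
move=> [c [c0 cD ciso ->]] [s] /=; rewrite in_itv/= => /andP[s0 sD] <-.
have -> : d x (c s) = s.
  rewrite -[x]c0 ciso ?in_itv/= ?lexx ?s0 ?mdist_ge0//.
  by rewrite sub0r normrN ger0_norm.
have -> : d (c s) y = d x y - s.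
  rewrite -[X in d _ X]cD ciso ?in_itv/= ?s0 ?sD ?lexx ?mdist_ge0//.
  by rewrite distrC ger0_norm ?subr_ge0.
lra.
Qed.

Lemma geodesic_ends x y S : geodesic_segment x y S -> S x /\ S y.
Proof.
move=> [c [c0 cD _ ->]]; split.
  by exists 0 => //=; rewrite in_itv/= lexx mdist_ge0.
by exists (d x y) => //=; rewrite in_itv/= lexx mdist_ge0.
Qed.

(* The point of [x, z] at which the nearby points pass from the side [x, o] to
   the side [z, o]. *)
Lemma slim_switch (delta : R) x z o Sxz Szo Sxo : 0 <= delta ->
  slim_triangles X delta ->
  geodesic_segment x z Sxz -> geodesic_segment z o Szo ->
  geodesic_segment x o Sxo ->
  exists p q r, [/\ Sxz p, Szo q, Sxo r, d p q <= delta + 1 &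
                 d p r <= delta + 1].
Proof.
move=> de0 slim gxz gzo gxo; have := slim _ _ _ _ _ _ gxz gzo gxo.
have [[Sx0 _] [Sz0 _]] := (geodesic_ends gxo, geodesic_ends gzo).
case: gxz => c [c0 cD ciso ->] near.
pose A := [set t | t \in `[0, d x z] /\ exists2 r, Sxo r & d (c t) r <= delta].
have A0 : A 0.
  split; first by rewrite in_itv/= lexx mdist_ge0.
  by exists x => //; rewrite c0 mdistxx.
have supA : has_sup A.
  split; first by exists 0.
  by exists (d x z) => t [] /=; rewrite in_itv/= => /andP[].
(* The supremum need not be attained; a parameter within 1 of it suffices, and this 1 is the one in
   [delta + 1]. *)
have [t [tD [r Sr dr]] st] := sup_adherent ltr01 supA.
move: (tD); rewrite in_itv/= => /andP[t0 t1].
have [tD1|tD1] := leP (t + 1) (d x z).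
- have t1D : t + 1 \in `[0, d x z] by rewrite in_itv/=; apply/andP; split; lra.
  have dt1 : d (c t) (c (t + 1)) = 1.
    by rewrite ciso// distrC addrAC subrr add0r normr1.
  have nA : ~ A (t + 1).
    move=> At1; have : t + 1 <= sup A by apply: ub_le_sup; [case: supA|].
    move: st; lra.
  have [] := near (c (t + 1)); first by exists (t + 1).
  move=> q [Sq|Sq] dq; last by exfalso; apply: nA; split => //; exists q.
  exists (c t), q, r; split => //; first by exists t.
    by have := mdist_via (c (t + 1)) (c t) q; lra.
  lra.
- exists (c t), z, r; split => //; first by exists t.
    rewrite -[X in d _ X]cD ciso// ?in_itv/= ?lexx ?mdist_ge0//.
    by rewrite distrC ger0_norm; lra.
  lra.
Qed.

(** The point [p] of [x, z] is close to both [x, o] and [z, o], and slimness puts it close to [z, y]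
    or [x, y]. Regrouping the four half-segments at [p] gives the alternative that corresponds to
    that side. *)
Lemma hyperbolic_four_point : hyperbolic_space X ->
  exists2 dl : R, 0 <= dl & four_point X dl.
Proof.
move=> [geo [delta de0 slim]]; exists (6 * (delta + 1)); first lra.
move=> x y z o.
have [Sxz gxz] := geo x z; have [Szo gzo] := geo z o.
have [Sxo gxo] := geo x o; have [Szy gzy] := geo z y.
have [Sxy gxy] := geo x y.
have [p [q [r [Sp Sq Sr pq pr]]]] := slim_switch de0 slim gxz gzo gxo.
have [q' Sq' pq'] := slim _ _ _ _ _ _ gxz gzy gxy _ Sp.
have := geodesic_split gxz Sp; have := geodesic_split gzo Sq.
have := geodesic_split gxo Sr.
have := mdist_via r x p; have := mdist_via r p o.
have := mdist_via q p z; have := mdist_via q p o.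
have := mdist_via q' p o; have := mdist_via q' o x; have := mdist_via q' o y.
have := mdist_via q' o z; have := mdist_via p q' o.
have := mdist_via p o q'.
rewrite (metric_sym r p) (metric_sym o q') (metric_sym o p) (metric_sym q z).
rewrite (metric_sym o x) (metric_sym o y) (metric_sym o z).
case: Sq' => Sq'.
- have := geodesic_split gzy Sq'.
  rewrite (metric_sym z q') (metric_sym z y); right; lra.
- have := geodesic_split gxy Sq'.
  rewrite (metric_sym x q'); left; lra.
Qed.

End SlimTriangles.

(** * Commensurators, and limit points *)

Section IntegerPowers.
Local Open Scope group_scope.
Variable G : groupType.
Implicit Types (a g : G) (i j : int).

Definition zpow a i : G :=
  match i with Posz n => a ^+ n | Negz n => a ^- n.+1 end.

Lemma zpow0 a : zpow a 0%R = 1. Proof. by []. Qed.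

Lemma zpow1 a : zpow a 1%R = a. Proof. by []. Qed.

Lemma zpow_nat a (n : nat) : zpow a n%:Z%R = a ^+ n. Proof. by []. Qed.

Lemma zpowNn a (n : nat) : zpow a (- n%:Z)%R = a ^- n.
Proof. by case: n => [|n]; rewrite ?oppr0 ?expg0 ?invg1// -NegzE. Qed.

Lemma zpowS a i : zpow a (i + 1)%R = zpow a i * a.
Proof.
case: i => n; first by rewrite -PoszD zpow_nat addn1 expgSr.
have -> : (Negz n + 1 = - n%:Z)%R by rewrite NegzE -addn1 PoszD opprD addrNK.
by rewrite zpowNn /= expgS invgM mulgVK.
Qed.

Lemma zpowD a i j : zpow a (i + j)%R = zpow a i * zpow a j.
Proof.
elim/int_ind: j => [|n IH|n IH]; first by rewrite addr0 mulg1.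
  by rewrite -addn1 PoszD addrA !zpowS IH mulgA.
have e k : zpow a (k - 1)%R = zpow a k * a^-1.
  by rewrite -{2}[k](subrK 1%R) zpowS mulgK.
by rewrite -addn1 PoszD opprD addrA !e IH mulgA.
Qed.

Lemma zpowN a i : zpow a (- i)%R = (zpow a i)^-1.
Proof. by apply: (mulIg (zpow a i)); rewrite -zpowD addNr mulVg. Qed.

Lemma zpowM a i j : zpow a (i * j)%R = zpow (zpow a i) j.
Proof.
elim/int_ind: j => [|n IH|n IH]; first by rewrite mulr0.
  by rewrite -addn1 PoszD mulrDr mulr1 !zpowD IH zpow1.
rewrite -addn1 PoszD opprD mulrDr mulrN1 mulrN -mulrN !zpowD IH; congr (_ * _).
by rewrite !zpowN zpow1.
Qed.

Lemma zpow_conj g a i : zpow (g * a * g^-1) i = g * zpow a i * g^-1.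
Proof.
elim/int_ind: i => [|n IH|n IH]; first by rewrite !zpow0 mulg1 mulgV.
  by rewrite -addn1 PoszD !zpowD IH !zpow1 !mulgA mulgVK.
rewrite -addn1 PoszD opprD !zpowD IH !zpowN !zpow1 !invgM invgK !mulgA.
by rewrite mulgVK.
Qed.

(** The commensurator of the cyclic group of [a]. For a loxodromic element of an acylindrical action
    this is its maximal virtually cyclic subgroup; its cosets index the essentially different
    translates of the axis. *)
Definition commensurating a g : Prop :=
  exists s t : int, [/\ s != 0%R, t != 0%R & g * zpow a s = zpow a t * g].

Lemma commensuratingV a g : commensurating a g -> commensurating a g^-1.
Proof.
move=> [s [t [s0 t0 h]]]; exists t, s; split => //.
by apply: (mulgI g); rewrite !mulgA mulgV mul1g h mulgK.
Qed.

Lemma commensuratingM a g h :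
  commensurating a g -> commensurating a h -> commensurating a (g * h).
Proof.
have pow k s t j : k * zpow a s = zpow a t * k ->
    k * zpow a (s * j)%R = zpow a (t * j)%R * k.
  move=> hk; rewrite !zpowM; have -> : zpow a t = k * zpow a s * k^-1.
    by rewrite hk mulgK.
  by rewrite zpow_conj mulgVK.
move=> [s [t [s0 t0 hg]]] [s' [t' [s0' t0' hh]]].
exists (s' * s)%R, (t * t')%R; split; rewrite ?mulf_neq0//.
by rewrite -mulgA (pow _ _ _ _ hh) mulgA mulrC (pow _ _ _ _ hg) mulgA.
Qed.

Lemma commensurating_pow a i : commensurating a (zpow a i).
Proof. by exists 1%R, 1%R; split => //; rewrite -!zpowD addrC. Qed.

End IntegerPowers.

Arguments zpow : simpl never.

Lemma invg_conj (G : groupType) (x y : G) :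
  ((x * y * x^-1)^-1 = x * y^-1 * x^-1)%g.
Proof. by rewrite !invgM invgK mulgA. Qed.

(** This and the next lemma express that lying in the same coset of the commensurator is an
    equivalence relation. *)
Lemma commensurating_left (G : groupType) (a k x y : G) :
  commensurating a (k^-1 * x)%g -> commensurating a (k^-1 * y)%g ->
  commensurating a (x^-1 * y)%g.
Proof.
move=> /commensuratingV hx hy; have := commensuratingM hx hy.
by rewrite invgM invgK !mulgA mulgK.
Qed.

Lemma commensurating_right (G : groupType) (a x y z : G) :
  commensurating a (x^-1 * z)%g -> commensurating a (y^-1 * z)%g ->
  commensurating a (x^-1 * y)%g.
Proof.
move=> hx /commensuratingV hy; have := commensuratingM hx hy.
by rewrite invgM invgK !mulgA mulgK.
Qed.

Section PartialProducts.
Variable G : groupType.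
Implicit Types (e : nat -> G) (n p : nat).

Fixpoint partial_prod (e : nat -> G) n : G :=
  if n is m.+1 then (partial_prod e m * e m)%g else 1%g.

Lemma partial_prodS (e : nat -> G) p n :
  partial_prod e (p + n) = (partial_prod e p * partial_prod (fun q =>
    e (p + q)%N) n)%g.
Proof. by elim: n => [|n IH]; rewrite ?addn0 ?mulg1// addnS /= IH mulgA. Qed.

Lemma eq_partial_prod (e e' : nat -> G) p :
  (forall n, (n < p)%N -> e n = e' n) -> partial_prod e p = partial_prod e' p.
Proof.
elim: p => //= p IH h; rewrite IH ?h// => n np.
by apply: h; apply: ltn_trans np _.
Qed.

Lemma partial_prod_nth T (F : T -> G) x0 (s : seq T) :
  partial_prod (fun n => F (nth x0 s n)) (size s) = (\prod_(x <- s) F x)%g.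
Proof.
elim: s => [|x s IH]; first by rewrite big_nil.
by rewrite big_cons -IH -[size _]/(1 + size s)%N partial_prodS /= mul1g.
Qed.

Lemma partial_prodD e p n : (forall i : nat, e (p + i)%N = e i) ->
  partial_prod e (p + n) = (partial_prod e p * partial_prod e n)%g.
Proof. by move=> pe; rewrite partial_prodS; congr (_ * _)%g;
  apply: eq_partial_prod. Qed.

Lemma partial_prod_pow e p n : (forall i : nat, e (p + i)%N = e i) ->
  partial_prod e (n * p) = (partial_prod e p ^+ n)%g.
Proof.
by move=> pe; elim: n => [|n IH] //; rewrite mulSn partial_prodD// IH expgS.
Qed.

End PartialProducts.

(** * From limit points to directions of the orbit *)

Section LimitPoints.
Variables (R : realType) (X : metricType R) (dl : R).
Hypotheses (dl0 : 0 <= dl) (fp : four_point X dl).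
Implicit Types (o x y z : X) (u v w : nat -> X).
Local Notation exc := (@excess R X).
Local Notation d := (@mdist R X).

Lemma gromov_productE o x y : gromov_product o x y = exc x o y / 2.
Proof. by rewrite /gromov_product /excess (metric_sym x o). Qed.

Lemma gromov_productC o x y : gromov_product o x y = gromov_product o y x.
Proof. by rewrite !gromov_productE excess_sym. Qed.

Lemma gromov_product_min o x y z M : M <= gromov_product o x y ->
  M <= gromov_product o y z -> M - dl / 2 <= gromov_product o x z.
Proof.
rewrite !gromov_productE => h1 h2.
by case: (excess_min fp y o z x); rewrite ?(excess_sym y o x); lra.
Qed.

Lemma asymptotic_sym o u v : gromov_asymptotic o u v -> gromov_asymptotic o v u.
Proof.
move=> h M; have [N hN] := h M; exists N => i j Ni Nj.
by rewrite gromov_productC hN.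
Qed.

Lemma asymptotic_trans o u v w : gromov_asymptotic o u v ->
  gromov_asymptotic o v w -> gromov_asymptotic o u w.
Proof.
move=> uv vw M; have [N1 h1] := uv (M + dl / 2);
  have [N2 h2] := vw (M + dl / 2).
exists (maxn N1 N2) => i j; rewrite !geq_max => /andP[i1 i2] /andP[j1 j2].
have := gromov_product_min (h1 _ _ i1 (leq_maxl N1 N2))
  (h2 _ _ (leq_maxr N1 N2) j2).
by lra.
Qed.

(** Were the products unbounded along far indices, convergence of [v1] and [v2] would spread this to
    all far pairs by the four-point inequality, and the two classes would be equal. *)
Lemma limit_points_separated o u1 u2 v1 v2 :
  boundary_class o u1 v1 -> boundary_class o u2 v2 ->
  boundary_class o u1 <> boundary_class o u2 ->
  exists M N, forall i j, (N <= i)%N -> (N <= j)%N -> exc (v1 i) o (v2 j) <= M.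
Proof.
move=> [c1 a1] [c2 a2]; apply: contra_notP => h.
have v12 : gromov_asymptotic o v1 v2.
  move=> M; have [N1 h1] := c1 (M + dl); have [N2 h2] := c2 (M + dl).
  exists (maxn N1 N2) => i j; rewrite !geq_max => /andP[i1 i2] /andP[j1 j2].
  have [i' [j' [i1' j2' h']]] : exists i' j', [/\ (N1 <= i')%N, (N2 <= j')%N &
      M + dl <= gromov_product o (v1 i') (v2 j')].
    apply: contra_notP h => h; exists (2 * (M + dl)), (maxn N1 N2) => i' j'.
    rewrite !geq_max => /andP[i1' i2'] /andP[j1' j2'].
    rewrite leNgt; apply/negP => h'; apply: h; exists i', j'; split => //.
    by rewrite gromov_productE; lra.
  have := gromov_product_min (h1 _ _ i1 i1') h'; have := h2 _ _ j2' j2.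
  move=> h3 h4; have h5 : M + dl / 2 <= gromov_product o (v2 j') (v2 j).
    by have := dl0; lra.
  have h6 : M + dl / 2 <= gromov_product o (v1 i) (v2 j') by lra.
  have := gromov_product_min h6 h5; lra.
have u12 : gromov_asymptotic o u1 u2.
  by apply: asymptotic_trans a1 _;
    apply: asymptotic_trans v12 (asymptotic_sym a2).
apply/seteqP; split => w [cw aw]; split => //.
  exact: asymptotic_trans (asymptotic_sym u12) aw.
exact: asymptotic_trans u12 aw.
Qed.

(** The form in which non-elementarity is used: two directions produce a loxodromic element, and
    three show that the orbit does not stay near its axis. *)
Lemma nonelementary_directions (G : groupType) (act : G -> X -> X) :
  nonelementary act -> exists (o : X) (M : R), forall L : R,
  exists g1 g2 g3 : G,
    [/\ L <= d o (act g1 o), L <= d o (act g2 o) & L <= d o (act g3 o)] /\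
    [/\ exc (act g1 o) o (act g2 o) <= M, exc (act g1 o) o (act g3 o) <= M &
        exc (act g2 o) o (act g3 o) <= M].
Proof.
move=> [x0 [? [? [? [[l1 l2 l3] [n12 n13 n23]]]]]].
case: l1 l2 l3 n12 n13 n23 => [[u1 _ <-] [g1 h1]] [[u2 _ <-] [g2 h2]].
move=> [[u3 _ <-] [g3 h3]] n12 n13 n23.
have [M1 [N1 b12]] := limit_points_separated h1 h2 n12.
have [M2 [N2 b13]] := limit_points_separated h1 h3 n13.
have [M3 [N3 b23]] := limit_points_separated h2 h3 n23.
exists x0, (Num.max M1 (Num.max M2 M3)) => L.
have far u v : boundary_class x0 u v ->
    exists N, forall i, (N <= i)%N -> L <= d x0 (v i).
  move=> [cv _]; have [N hN] := cv L; exists N => i Ni.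
  have := hN _ _ Ni Ni; rewrite gromov_productE /excess mdistxx.
  by rewrite (metric_sym (v i)); lra.
have [K1 f1] := far _ _ h1; have [K2 f2] := far _ _ h2.
have [K3 f3] := far _ _ h3.
pose n := (N1 + N2 + N3 + K1 + K2 + K3)%N.
exists (g1 n), (g2 n), (g3 n); split; split.
- by apply: f1; rewrite /n; lia.
- by apply: f2; rewrite /n; lia.
- by apply: f3; rewrite /n; lia.
- by rewrite !le_max b12// /n; lia.
- by rewrite !le_max b13 ?orbT// /n; lia.
- by rewrite !le_max b23 ?orbT// /n; lia.
Qed.

End LimitPoints.

(** * Axes *)

Section Orbits.
Variables (R : realType) (G : groupType) (X : metricType R) (dl : R).
Hypotheses (dl0 : 0 <= dl) (fp : four_point X dl).
Variables (act : G -> X -> X) (o : X).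
Hypothesis iso : isometric_action act.
Implicit Types (a b f g h k : G) (i j l : int) (n m q t : nat).
Local Notation exc := (@excess R X).
Local Notation d := (@mdist R X).
Local Notation D g h := (mdist (act g%g o) (act h%g o)).
Local Notation E g k h := (excess (act g%g o) (act k%g o) (act h%g o)).

Lemma act1 x : act 1%g x = x. Proof. by case: iso. Qed.

Lemma actM g h x : act (g * h)%g x = act g (act h x). Proof. by case: iso. Qed.

Lemma orbit_distM k g h : D (k * g) (k * h) = D g h.
Proof. by rewrite !actM; case: iso. Qed.

Lemma orbit_dist1 g h : D 1 (g^-1 * h) = D g h.
Proof. by rewrite -(orbit_distM g) mulg1 mulVKg. Qed.

Lemma orbit_distV g : D 1 g^-1 = D 1 g.
Proof. by rewrite -(orbit_distM g) mulg1 mulgV metric_sym. Qed.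

Lemma orbit_distMr g h : D g (g * h) = D 1 h.
Proof. by rewrite -{1}[g]mulg1 orbit_distM. Qed.

Lemma orbit_excM f g k h : E (f * g) (f * k) (f * h) = E g k h.
Proof. by rewrite /excess !orbit_distM. Qed.

Lemma partial_prod_middle e C L : 0 <= C -> 2 * C + 3 * dl < 2 * L ->
  (forall n, L <= D 1 (e n)) -> (forall n, E (e n)^-1 1 (e n.+1) <= C) ->
  forall n m q, (n <= m)%N -> (m <= q)%N ->
  E (partial_prod e n) (partial_prod e m) (partial_prod e q) <= C + 2 * dl.
Proof.
move=> C0 LC le ce n m q nm mq.
pose t (i : nat) := act (partial_prod e i) o.
have ht : forall i : nat, (i.+1 < q)%N -> L <= d (t i) (t i.+1).
  by move=> i _; rewrite /t /= orbit_distMr.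
apply: (broken_middle dl0 fp ht _ C0 LC nm mq (leqnn q)).
move=> i _; rewrite /t /=;
  rewrite -{1}[partial_prod e i](mulgK (e i)) -[(_ * e i)%g in X in E _ X
    _]mulg1.
  by rewrite orbit_excM.
Qed.

Lemma partial_prod_growth e C L : 0 <= C -> 2 * C + 3 * dl < 2 * L ->
  (forall n, L <= D 1 (e n)) -> (forall n, E (e n)^-1 1 (e n.+1) <= C) ->
  forall n, D 1 (partial_prod e n) + D 1 (e n) - (C + 2 * dl) <= D 1
    (partial_prod e n.+1).
Proof.
move=> C0 LC le ce n.
have := partial_prod_middle C0 LC le ce (leq0n n) (leqnSn n).
by rewrite /excess /= orbit_distMr; lra.
Qed.

(** [a] is loxodromic with a quasi-geodesic orbit of powers. The slope 1 in the lower bound is a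
    normalization, achieved by taking the syllables long. *)
Definition axial a (K : R) : Prop :=
  (forall i j l, i <= j -> j <= l ->
    E (zpow a i) (zpow a j) (zpow a l) <= K) /\
  forall i, (`|i|%N)%:R <= D 1 (zpow a i).

Lemma axial_nat a K :
  (forall n m, (n <= m)%N -> E 1 (a ^+ n) (a ^+ m) <= K) ->
  (forall n, n%:R <= D 1 (a ^+ n)) -> axial a K.
Proof.
move=> h1 h2; split=> [i j l ij jl|i].
- have [n jE] : exists n, j = i + n%:Z by exists `|j - i|%N; lia.
  have [m lE] : exists m, l = i + (n + m)%N%:Z by exists `|l - j|%N; lia.
  rewrite lE jE !zpowD -[X in E X _ _]mulg1 orbit_excM !zpow_nat.
  by rewrite h1 ?leq_addr.
- have [[n ->]|[n ->]] : (exists n, i = n%:Z) \/ (exists n, i = - n%:Z).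
  + by case: i => n; [left; exists n|right; exists n.+1; rewrite NegzE].
  + by rewrite zpow_nat absz_nat h2.
  + by rewrite zpowNn abszN absz_nat orbit_distV h2.
Qed.

Lemma periodic_axial e p C L : 0 <= C -> 2 * C + 3 * dl < 2 * L ->
  C + 2 * dl + 1 <= L -> (0 < p)%N -> (forall i : nat, e (p + i)%N = e i) ->
  (forall n, L <= D 1 (e n)) -> (forall n, E (e n)^-1 1 (e n.+1) <= C) ->
  axial (partial_prod e p) (C + 2 * dl).
Proof.
move=> C0 LC LC1 p0 pe le ce; apply: axial_nat => [n m nm|n].
- rewrite -!partial_prod_pow//;
    apply: (partial_prod_middle C0 LC le ce (leq0n _)).
  by rewrite leq_mul2r nm orbT.
- have gr q : q%:R <= D 1 (partial_prod e q).
    elim: q => [|q IH]; first by rewrite mdist_ge0.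
    have := partial_prod_growth C0 LC le ce q; have := le q.
    by rewrite -natr1; lra.
  rewrite -partial_prod_pow//; apply: le_trans (gr _); rewrite ler_nat.
  by rewrite leq_pmulr.
Qed.

(** One of [g], [h], [g * h^-1] is axial. If [g] and [h] both backtrack when squared, [g^-1] points
    in the direction of [g] and [h^-1] in that of [h], so [g^-1] and [h^-1] diverge as [g] and [h]
    do. Comparing along [g], [g^-1], [h^-1], [h] takes two four-point inequalities, hence the 2dl in
    [C]. *)
Lemma exists_axial (M : R) :
  (forall L : R, exists g h,
    [/\ L <= D 1 g, L <= D 1 h & E g 1 h <= M]) ->
  exists a K, axial a K.
Proof.
move=> dir; have dl0' := dl0.
pose C := M + 2 * dl.
have [g [h [Lg Lh gh]]] := dir (2 * C + 3 * dl + 1).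
have M0 : 0 <= M by apply: le_trans gh; exact: excess_ge0.
have C0 : 0 <= C by rewrite /C; lra.
have LC : 2 * C + 3 * dl < 2 * (2 * C + 3 * dl + 1) by lra.
have LC1 : C + 2 * dl + 1 <= 2 * C + 3 * dl + 1 by lra.
have one k : 2 * C + 3 * dl + 1 <= D 1 k -> E k 1 k^-1 <= C ->
    exists a K, axial a K.
  move=> Lk kk; exists (partial_prod (fun=> k) 1), (C + 2 * dl).
  apply: (periodic_axial C0 LC LC1) => // _.
  by rewrite excess_sym.
have [gg|gg] := leP (E g 1 g^-1) C; first exact: one gg.
have [hh|hh] := leP (E h 1 h^-1) C; first exact: one hh.
have [gV|gV] := leP (E g^-1 1 h^-1) C.
- exists (partial_prod (fun n => if odd n then h^-1%g else g) 2), (C + 2 * dl).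
  apply: (periodic_axial C0 LC LC1) => //.
  + by move=> i; rewrite add2n /= negbK.
  + by move=> n; case: odd; rewrite ?orbit_distV.
  + move=> n /=; case: odd => //=.
    by rewrite invgK excess_sym; apply: le_trans gh _; rewrite /C; lra.
exfalso; move: gg hh gV gh; rewrite /C => gg hh gV gh.
have := excess_min fp (act g o) (act 1 o) (act h^-1 o) (act g^-1 o).
have := excess_min fp (act h o) (act 1 o) (act g o) (act h^-1 o).
have := excess_sym (act h o) (act 1 o) (act g o).
have := excess_sym (act h^-1 o) (act 1 o) (act g o).
have := excess_min fp (act g^-1 o) (act 1 o) (act h o) (act g o).
have := excess_sym (act g^-1 o) (act 1 o) (act g o).
have := excess_min fp (act h^-1 o) (act 1 o) (act g^-1 o) (act h o).
have := excess_sym (act h^-1 o) (act 1 o) (act h o).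
have := excess_sym (act h^-1 o) (act 1 o) (act g^-1 o).
have := excess_sym (act g^-1 o) (act 1 o) (act h o).
lra.
Qed.

End Orbits.

(** * Acylindricity and overlaps of an axis with its translates *)

Section AxisOverlap.
Variables (R : realType) (G : groupType) (X : metricType R) (dl : R).
Hypotheses (dl0 : 0 <= dl) (fp : four_point X dl).
Variables (act : G -> X -> X) (o : X).
Hypothesis iso : isometric_action act.
Implicit Types (a b f g h k : G) (i j l : int) (n m q t : nat).
Local Notation exc := (@excess R X).
Local Notation d := (@mdist R X).
Local Notation D g h := (mdist (act g%g o) (act h%g o)).
Local Notation E g k h := (excess (act g%g o) (act k%g o) (act h%g o)).

Lemma acylindrical_pigeonhole c : acylindrical act -> 0 < c ->
  exists (L : R) N, 0 < L /\ forall x y (phi : nat -> G), L < d x y ->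
    (forall n, (n <= N)%N ->
      d x (act (phi n) x) < c /\ d y (act (phi n) y) < c) ->
    exists n m, [/\ (n < m)%N, (m <= N)%N & phi n = phi m].
Proof.
move=> acyl c0; have [L [N [L0 N0 hN]]] := acyl c c0.
exists L, N; split => // x y phi Lxy hphi; have [n nN cardA] := hN x y Lxy.
move: cardA; set A := [set g | _] => cardA.
apply: contrapT => inj.
have injphi : {in `I_N.+1 &, injective phi}.
  move=> p q; rewrite !inE /= !ltnS => pN qN pq.
  have [pq'|pq'|//] := ltngtP p q; exfalso; apply: inj.
    by exists p, q.
  by exists q, p.
have : (`I_N.+1 #<= A)%card.
  apply: (@card_le_trans _ _ _ (phi @` `I_N.+1)).
    by have /card_eqPle[] := inj_card_eq injphi.
  by apply: subset_card_le => _ [p /= pN <-]; apply: hphi.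
have /card_eqPle[An _] := cardA => IA.
have := card_le_trans IA An; rewrite card_le_II => /(ltn_trans nN).
by rewrite ltnn.
Qed.

Section Axis.
Variables (a : G) (K : R).
Hypothesis axa : axial act o a K.

Lemma axial_ge0 : 0 <= K.
Proof.
by case: axa => /(_ 0 0 0 (lexx _) (lexx _)) + _; apply: le_trans;
  exact: excess_ge0.
Qed.

Lemma axial_step_ge1 : 1 <= D 1 a.
Proof. by case: axa => _ /(_ 1). Qed.

Lemma axial_distS i : D (zpow a i) (zpow a (i + 1)) = D 1 a.
Proof. by rewrite zpowD zpow1 (orbit_distMr _ iso). Qed.

Lemma axial_dist_pow i : D 1 (zpow a i) <= (`|i|%N)%:R * D 1 a.
Proof.
have h n : D 1 (a ^+ n) <= n%:R * D 1 a.
  elim: n => [|n IH]; first by rewrite mdistxx mul0r.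
  rewrite expgSr -natr1 mulrDl mul1r;
    apply: le_trans (mdist_via (act (a ^+ n) o) _ _) _.
  by rewrite (orbit_distMr _ iso) lerD.
by case: i => n; [exact: h|rewrite /zpow (orbit_distV _ iso); exact: h].
Qed.

Lemma axial_dist i j : D (zpow a i) (zpow a j) = D 1 (zpow a (j - i)).
Proof. by rewrite -(orbit_dist1 _ iso) -zpowN -zpowD addrC. Qed.

Lemma axial_between i j l : (i <= j <= l) || (l <= j <= i) ->
  E (zpow a i) (zpow a j) (zpow a l) <= K.
Proof.
case: axa => ax _ /orP[]/andP[ij jl]; first exact: ax.
by rewrite excess_sym ax.
Qed.

(** The signs [i], [j] allow for antiparallel axes. Points of equal index have equal distance from
    the start of their own axis, also for opposite signs, so [excess_near] applies. *)
Lemma parallel_fellow g i j q (c : R) : 0 <= c -> `|i|%N = 1%N ->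
  `|j|%N = 1%N ->
  forall n m, D 1 g <= c ->
    D (zpow a (i * n%:Z)) (g * zpow a (j * m%:Z)) <= c ->
  (q <= n)%N -> (q <= m)%N ->
  D (zpow a (i * q%:Z)) (g * zpow a (j * q%:Z)) <= 5 * c + K + dl.
Proof.
move=> c0 i1 j1 n m g1 g2 qn qm.
have h1 : E 1 (zpow a (i * q%:Z)) (zpow a (i * n%:Z)) <= K.
  by rewrite -[X in E X _ _](zpow0 a); apply: axial_between; lia.
have h2 : E 1 (zpow a (j * q%:Z)) (zpow a (j * m%:Z)) <= K.
  by rewrite -[X in E X _ _](zpow0 a); apply: axial_between; lia.
have h3 : E 1 (g * zpow a (j * q%:Z)) (zpow a (i * n%:Z)) <= K + 4 * c.
  have := excess_endl (act g o) (act 1 o) (act (g * zpow a (j * q%:Z)) o)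
    (act (zpow a (i * n%:Z)) o).
  have := excess_end (act g o) (act (g * zpow a (j * q%:Z)) o)
    (act (g * zpow a (j * m%:Z)) o) (act (zpow a (i * n%:Z)) o).
  have := orbit_excM o iso g 1 (zpow a (j * q%:Z)) (zpow a (j * m%:Z)).
  rewrite mulg1 => ->; rewrite metric_sym in g1; rewrite metric_sym in g2.
  by move: h2 g1 g2; lra.
have h4 : D 1 (zpow a (i * q%:Z)) = D 1 (zpow a (j * q%:Z)).
  have [->//|->] : i = j \/ i = - j by lia.
  by rewrite mulNr zpowN (orbit_distV _ iso).
have := @excess_near _ _ _ fp (act 1 o) (act (zpow a (i * n%:Z)) o)
  (act (zpow a (i * q%:Z)) o) (act (g * zpow a (j * q%:Z)) o) (K + 4 * c) c.
have -> : 5 * c + K + dl = c + (K + 4 * c) + dl by lra.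
apply => //; first by lra.
rewrite h4 ler_norml.
have := mdist_via (act g o) (act 1 o) (act (g * zpow a (j * q%:Z)) o).
have := mdist_via (act 1 o) (act g o) (act (g * zpow a (j * q%:Z)) o).
by rewrite !(orbit_distMr _ iso) (metric_sym (act g o)); move: g1; lra.
Qed.

(** For [t] up to [N] the elements a^(-it) g a^(jt) g^-1, with signs i and j, move two distant
    points of the translated axis by a bounded amount. By pigeonhole two of them coincide, which
    says that [g] conjugates a power of [a] to a power of [a]. *)
Lemma overlap_commensurating (c : R) : acylindrical act -> 0 <= c ->
  exists B : nat, forall g i j i' j',
    D (zpow a i) (g * zpow a j) <= c -> D (zpow a i') (g * zpow a j') <= c ->
    (B <= `|(i' - i)%R|)%N -> commensurating a g.
Proof.
move=> acyl c0; pose F := 5 * c + K + dl.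
have F0 : 0 < 2 * F + 1 by rewrite /F; have := axial_ge0; have := dl0; lra.
have [L [N [L0 pig]]] := acylindrical_pigeonhole acyl F0.
pose r := (Num.bound L).+1; have Lr : L < r%:R.
  apply: lt_trans (archi_boundP (ltW L0)) _; by rewrite ltr_nat.
(* The indices up to [N] feed the pigeonhole, [r] more keep the two test points further apart than
   [L], and the last summand forces [m] to reach N + r as well. *)
pose B := (N + r + Num.bound (2 * c + (N + r)%:R * D 1 a))%N.
have core g i j n m : `|i|%N = 1%N -> `|j|%N = 1%N -> D 1 g <= c ->
    D (zpow a (i * n%:Z)) (g * zpow a (j * m%:Z)) <= c -> (B <= n)%N ->
    commensurating a g.
  move=> i1 j1 g1 g2 Bn.
  have mN : (N + r <= m)%N.
    rewrite leqNgt; apply/negP => mN.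
    have : D 1 (zpow a (j * m%:Z)) <= (N + r)%:R * D 1 a.
      apply: le_trans (axial_dist_pow _) _; rewrite abszM j1 mul1n absz_nat.
      by rewrite ler_wpM2r ?mdist_ge0// ler_nat ltnW.
    have : n%:R <= D 1 (zpow a (i * n%:Z)).
      by case: axa => _ /(_ (i * n%:Z)); rewrite abszM i1 mul1n absz_nat.
    have : 2 * c + (N + r)%:R * D 1 a < n%:R.
      apply: lt_le_trans (archi_boundP _) _.
        by rewrite addr_ge0 ?mulr_ge0 ?mdist_ge0.
      by rewrite ler_nat; apply: leq_trans Bn; rewrite leq_addl.
    have := mdist_via (act g o) (act 1 o) (act (zpow a (i * n%:Z)) o).
    have := mdist_via (act (g * zpow a (j * m%:Z)) o) (act g o) (act (zpow a (i
      * n%:Z)) o).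
    rewrite (orbit_distMr _ iso) (metric_sym (act (g * _) o)); move: g1 g2.
    by set u := (_ * _)%R; lra.
  have nN : (N + r <= n)%N by apply: leq_trans Bn; rewrite leq_addr.
  have fel q : (q <= N + r)%N ->
      D (zpow a (i * q%:Z)) (g * zpow a (j * q%:Z)) <= F.
    move=> qN; apply: parallel_fellow g2 _ _ => //; exact: leq_trans qN _.
  pose phi t := (zpow a (- (i * t%:Z)) * g * zpow a (j * t%:Z) * g^-1)%g.
  have [] := pig (act g o) (act (g * zpow a (j * r%:Z)) o) phi.
  - rewrite (orbit_distMr _ iso); apply: lt_le_trans Lr _.
    by case: axa => _ /(_ (j * r%:Z)); rewrite abszM j1 mul1n absz_nat.
  - move=> t tN; rewrite -!(actM iso) /phi mulgVK; split.
    + have -> : D g (zpow a (- (i * t%:Z)) * g * zpow a (j * t%:Z)) =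
          D (zpow a (i * t%:Z) * g) (g * zpow a (j * t%:Z)).
        rewrite -(orbit_distM _ iso (zpow a (i * t%:Z))) !mulgA -zpowD subrr.
        by rewrite zpow0 mul1g.
      have := mdist_via (act (zpow a (i * t%:Z)) o) (act (zpow a (i * t%:Z) *
        g) o)
        (act (g * zpow a (j * t%:Z)) o).
      rewrite (metric_sym (act (_ * g) o) (act (zpow a (i * t%:Z)) o)).
      rewrite (orbit_distMr _ iso).
      have := fel t (leq_trans tN (leq_addr _ _)).
      by move: g1; rewrite /F; have := axial_ge0; have := dl0; lra.
    + have -> : D (g * zpow a (j * r%:Z)) (zpow a (- (i * t%:Z)) * g *
           zpow a (j * t%:Z) * g^-1 * (g * zpow a (j * r%:Z))) =
          D (zpow a (i * t%:Z) * (g * zpow a (j * r%:Z))) (g * zpow a (j * (t +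
            r)%N%:Z)).
        rewrite -(orbit_distM _ iso (zpow a (i * t%:Z))) !mulgA -zpowD subrr.
        by rewrite zpow0 mul1g mulgVK -!mulgA -zpowD PoszD mulrDr.
      have := mdist_via (act (zpow a (i * (t + r)%N%:Z)) o)
        (act (zpow a (i * t%:Z) * (g * zpow a (j * r%:Z))) o)
        (act (g * zpow a (j * (t + r)%N%:Z)) o).
      rewrite [in X in _ <= X + _]PoszD mulrDr zpowD (orbit_distM _ iso).
      rewrite (metric_sym (act (g * _) o)).
      have : (t + r <= N + r)%N by rewrite leq_add2r.
      move=> /fel; have /fel : (r <= N + r)%N by rewrite leq_addl.
      by rewrite PoszD mulrDr zpowD; lra.
  move=> t [t' [tt' t'N /mulIg phiE]].
  exists (j * (t' - t)%N%:Z), (i * (t' - t)%N%:Z); split.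
  - by lia.
  - by lia.
  - rewrite -subzn ?(ltnW tt')// !mulrBr !zpowD !mulgA.
    apply: (mulIg (zpow a (j * t%:Z)));
      rewrite -!mulgA -zpowD addNr zpow0 mulg1.
    apply: (mulgI (zpow a (- (i * t'%:Z)))).
    rewrite !mulgA in phiE *; rewrite -phiE.
    by rewrite -zpowD addNr zpow0 mul1g.
exists B => g i j i' j' h1 h2 BB.
(* Powers of [a] on both sides shift the overlap so that it starts at index 0; [s] records in which
   direction each axis is run. *)
have E1 : commensurating a (zpow a (- i) * g * zpow a j)%g.
  pose s (z : int) : int := if 0 <= z then 1 else -1.
  have sE (z : int) : s z * (`|z|%N)%:Z = z by rewrite /s; case: ifP; lia.
  apply: (core _ (s (i' - i)) (s (j' - j)) `|i' - i|%N `|j' - j|%N) => //.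
  - by rewrite /s; case: ifP.
  - by rewrite /s; case: ifP.
  - rewrite -(orbit_distM _ iso (zpow a i)) !mulgA mulg1 -zpowD subrr zpow0.
    by rewrite mul1g.
  - rewrite !sE -(orbit_distM _ iso (zpow a i)) !mulgA -!zpowD subrr zpow0.
    by rewrite mul1g -mulgA -zpowD !subrKC.
have -> : g = (zpow a i * (zpow a (- i) * g * zpow a j) * zpow a (- j))%g.
  by rewrite !mulgA -zpowD subrr zpow0 mul1g -mulgA -zpowD subrr zpow0 mulg1.
apply: commensuratingM; last exact: commensurating_pow.
by apply: commensuratingM => //; exact: commensurating_pow.
Qed.

End Axis.
End AxisOverlap.

Lemma nat_crossing (R : realType) (f : nat -> R) (s r : R) n :
  (forall i : nat, f i.+1 <= f i + s) -> f 0%N <= r -> r <= f n ->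
  0 <= s -> exists2 q, (q <= n)%N & r <= f q <= r + s.
Proof.
move=> fS f0 fn s0.
have [rf0|f0r] := leP r (f 0%N).
  by exists 0%N => //; apply/andP; split; lra.
have [] := @nat_switch (fun i => f i < r) n => //; first by apply/negP;
  rewrite -leNgt.
move=> i [iN fi /negP]; rewrite -leNgt => fi1; exists i.+1 => //.
by have := fS i; rewrite fi1 /=; lra.
Qed.

Lemma int_crossing (R : realType) (f : int -> R) (s r : R) (i j : int) :
  (forall k : int, `|f (k + 1) - f k| <= s) -> f i <= r -> r <= f j ->
  exists2 l : int, (i <= l <= j) || (j <= l <= i) & `|f l - r| <= s.
Proof.
move=> fS fi fj; have s0 : 0 <= s by apply: le_trans (fS 0).
have step (k : int) : f (k + 1) <= f k + s /\ f k <= f (k + 1) + s.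
  by have := fS k; rewrite ler_norml => /andP[]; split; lra.
have [ij|ji] := leP i j.
- have [] := @nat_crossing _ (fun n : nat => f (i + n%:Z)) s r `|j - i|%N.
  + by move=> n /=; rewrite -addn1 PoszD addrA; case: (step (i + n%:Z)).
  + by rewrite addr0.
  + by have -> : i + `|j - i|%N%:Z = j by lia.
  + exact: s0.
  move=> q qn /andP[h1 h2]; exists (i + q%:Z); first by lia.
  by rewrite ler_norml; apply/andP; split; lra.
- have [] := @nat_crossing _ (fun n : nat => f (i - n%:Z)) s r `|i - j|%N.
  + move=> n /=; case: (step (i - n.+1%:Z)) => _.
    by have -> : i - n.+1%:Z + 1 = i - n%:Z by lia.
  + by rewrite subr0.
  + by have -> : i - `|i - j|%N%:Z = j by lia.
  + exact: s0.
  move=> q qn /andP[h1 h2]; exists (i - q%:Z); first by lia.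
  by rewrite ler_norml; apply/andP; split; lra.
Qed.

(** * Commensurating elements and the axis *)

Section Translates.
Variables (R : realType) (G : groupType) (X : metricType R) (dl : R).
Hypotheses (dl0 : 0 <= dl) (fp : four_point X dl).
Variables (act : G -> X -> X) (o : X).
Hypotheses (iso : isometric_action act) (acyl : acylindrical act).
Implicit Types (f g h k : G) (i j l : int) (n m q t : nat) (x y : X).
Variables (a : G) (K : R).
Hypothesis axa : axial act o a K.
Local Notation exc := (@excess R X).
Local Notation d := (@mdist R X).
Local Notation D g h := (mdist (act g%g o) (act h%g o)).
Local Notation E g k h := (excess (act g%g o) (act k%g o) (act h%g o)).
Local Notation tau := (D 1 a).

(** The relation keeps g a^(sj) at distance [D 1 g] from a^(tj) for all j. For large j the
    four-point inequality replaces the ends of the translated axis by ends of the axis itself, at a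
    cost of dl each, so [g] is close to an edge of the axis. *)
Lemma commensurating_near g : commensurating a g ->
  exists i, D g (zpow a i) <= 3 * K + 4 * dl + tau.
Proof.
have dl0' := dl0; have K0 := axial_ge0 axa.
have tau0 : 0 <= tau by exact: mdist_ge0.
move=> [s [t [s0 t0 gst]]].
have pow j : (g * zpow a (s * j) = zpow a (t * j) * g)%g.
  rewrite !zpowM; have ->
    : zpow a t = (g * zpow a s * g^-1)%g by rewrite gst mulgK.
  by rewrite zpow_conj mulgVK.
pose n := Num.bound (D 1 g + K + 2 * dl + 1).
have nb : D 1 g + K + 2 * dl + 1 < n%:R.
  by apply: archi_boundP; have := mdist_ge0 (act 1%g o) (act g o); lra.
have far j : `|j|%N = n -> D 1 g + K + 2 * dl + 1 <= D g (g * zpow a (s * j)).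
  move=> jn; rewrite (orbit_distMr _ iso); case: axa => _ /(_ (s * j)).
  apply: le_trans; apply: (le_trans (ltW nb));
    rewrite ler_nat abszM jn leq_pmull//.
  by rewrite absz_gt0.
have close j : D (zpow a (t * j)) (g * zpow a (s * j)) = D 1 g.
  by rewrite pow (orbit_distMr _ iso).
have mid : E (g * zpow a (s * - n%:Z)) g (g * zpow a (s * n%:Z)) <= K.
  rewrite -[X in E _ X _]mulg1 (orbit_excM _ iso) -(zpow0 a).
  by apply: (axial_between axa); lia.
have mid' : E (zpow a (t * - n%:Z)) g (zpow a (t * n%:Z)) <= K + 2 * dl.
  have := far n%:Z (absz_nat n); have := close n%:Z.
  have := far (- n%:Z); rewrite abszN absz_nat => /(_ erefl).
  have := close (- n%:Z).
  move: mid; set P := act (g * zpow a (s * - n%:Z))%g o.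
  set P' := act (g * zpow a (s * n%:Z))%g o.
  set Q := act (zpow a (t * - n%:Z)) o; set Q' := act (zpow a (t * n%:Z)) o.
  set z := act g o => mid cQ fQ cQ' fQ'.
  have h1 : K + 2 * dl < exc Q z P.
    have := mdist_via Q P z; have := mdist_via P z Q.
    rewrite /excess (metric_sym Q z) (metric_sym P Q) (metric_sym P z).
    by move: (mdist_ge0 (act 1%g o) z) => *; lra.
  have h2 : K + 2 * dl < exc Q' z P'.
    have := mdist_via Q' P' z; have := mdist_via P' z Q'.
    rewrite /excess (metric_sym Q' z) (metric_sym P' Q') (metric_sym P' z).
    by move: (mdist_ge0 (act 1%g o) z) => *; lra.
  have := excess_min fp Q z P' P; have := excess_min fp Q' z Q P'.
  rewrite (excess_sym Q') (excess_sym P'); lra.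
pose T (q : nat) := act (zpow a (- (`|t|%N * n)%N%:Z + q%:Z)) o.
have n0 : (0 < n)%N.
  rewrite -(ltr_nat R); apply: le_lt_trans nb.
  by have := mdist_ge0 (act 1%g o) (act g o); lra.
have [] := @excess_path_edge _ _ dl dl0 fp T (2 * (`|t|%N * n))%N K (K + 2 *
  dl) (act g o).
- by rewrite !muln_gt0 absz_gt0 t0 n0.
- by move=> j jM; apply: (axial_between axa); lia.
- exact: K0.
- rewrite /T addr0; have ->
    : - (`|t|%N * n)%N%:Z + (2 * (`|t|%N * n))%N%:Z = (`|t|%N * n)%N%:Z :> int.
    by lia.
  have [tp|tn] := leP 0 t.
    have <- : t * n%:Z = (`|t|%N * n)%N%:Z by lia.
    by rewrite -mulrN.
  have <- : t * - n%:Z = (`|t|%N * n)%N%:Z by lia.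
  by rewrite mulrN opprK excess_sym -mulrN.
move=> q _; rewrite /T -addn1 PoszD addrA; set i := - _ + _ => hq.
exists i; move: hq; rewrite /excess (axial_distS _ iso).
have := mdist_via (act (zpow a i) o) (act g o) (act (zpow a (i + 1)) o).
have := mdist_via (act (zpow a (i + 1)) o) (act (zpow a i) o) (act g o).
rewrite (metric_sym (act (zpow a (i + 1)) o)) (axial_distS _ iso).
by rewrite (metric_sym (act (zpow a i) o) (act g o)); lra.
Qed.

Lemma same_side i j (L : R) : (0 <= i) && (0 <= j) || (i <= 0) && (j <= 0) ->
  L <= D 1 (zpow a i) -> L <= D 1 (zpow a j) ->
  2 * L - K <= E (zpow a i) 1 (zpow a j).
Proof.
move=> ij Li Lj.
have : E 1 (zpow a i) (zpow a j) <= K \/ E 1 (zpow a j) (zpow a i) <= K.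
  have [h|h] := leP `|i|%N `|j|%N; [left|right];
    by rewrite -[X in E X _ _](zpow0 a); apply: (axial_between axa); lia.
move: Li Lj; rewrite /excess (metric_sym (act (zpow a i) o) (act 1 o)).
rewrite (metric_sym (act (zpow a i) o) (act (zpow a j) o)).
by move=> Li Lj []; lra.
Qed.

(** An orbit that stays near one axis has only two directions, and of three separated ones two would
    lie on the same side of 1. *)
Lemma exists_noncommensurating (M : R) :
  (forall L : R, exists g1 g2 g3,
    [/\ L <= D 1 g1, L <= D 1 g2 & L <= D 1 g3] /\
    [/\ E g1 1 g2 <= M, E g1 1 g3 <= M & E g2 1 g3 <= M]) ->
  exists f, ~ commensurating a f.
Proof.
move=> dir; apply: contrapT => /forallNP all.
pose K2 := 3 * K + 4 * dl + tau.
have near g : exists i, D g (zpow a i) <= K2.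
  by apply: commensurating_near; apply: contrapT; exact: all.
have [g1 [g2 [g3 [[L1 L2 L3] [M1 M2 M3]]]]] := dir (M + K + 4 * K2 + 1).
have [i1 n1] := near g1; have [i2 n2] := near g2; have [i3 n3] := near g3.
have far g i : M + K + 4 * K2 + 1 <= D 1 g -> D g (zpow a i) <= K2 ->
    M + K + 3 * K2 + 1 <= D 1 (zpow a i).
  have := mdist_via (act (zpow a i) o) (act 1 o) (act g o).
  by rewrite (metric_sym (act g o)); lra.
have sep g h i j : E g 1 h <= M -> D g (zpow a i) <= K2 ->
  D h (zpow a j) <= K2 ->
    E (zpow a i) 1 (zpow a j) <= M + 4 * K2.
  have := excess_end (act g o) (act 1 o) (act h o) (act (zpow a j) o).
  have := excess_endl (act g o) (act (zpow a i) o) (act 1 o) (act (zpow a j) o).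
  by lra.
have M0 : 0 <= M by apply: le_trans M1; exact: excess_ge0.
have K20 : 0 <= K2 by apply: le_trans n1; exact: mdist_ge0.
have K0 := axial_ge0 axa.
have clash i j : M + K + 3 * K2 + 1 <= D 1 (zpow a i) ->
    M + K + 3 * K2 + 1 <= D 1 (zpow a j) ->
      E (zpow a i) 1 (zpow a j) <= M + 4 * K2 ->
    ~~ ((0 <= i) && (0 <= j) || (i <= 0) && (j <= 0)).
  move=> hi hj hij; apply/negP => ij; have := same_side ij hi hj.
  by lra.
have := clash _ _ (far _ _ L1 n1) (far _ _ L2 n2) (sep _ _ _ _ M1 n1 n2).
have := clash _ _ (far _ _ L1 n1) (far _ _ L3 n3) (sep _ _ _ _ M2 n1 n3).
have := clash _ _ (far _ _ L2 n2) (far _ _ L3 n3) (sep _ _ _ _ M3 n2 n3).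
have [h1|/ltW h1] := leP 0 i1; have [h2|/ltW h2] := leP 0 i2;
  by have [h3|/ltW h3] := leP 0 i3; rewrite ?h1 ?h2 ?h3 /= ?orbT.
Qed.

(** Otherwise f^-1 a^p f, with p nonzero, is commensurating, and so are its powers. These lie near
    the axis, so the translate by [f] follows the axis without bound and [f] is commensurating. *)
Lemma exists_translates f : ~ commensurating a f ->
  forall n m, n != m -> ~ commensurating a ((a ^+ n * f)^-1 * (a ^+ m * f))%g.
Proof.
move=> nf n m nm; set c := (_ * _)%g => cc; apply: nf.
have cE : c = (f^-1 * zpow a (m%:Z - n%:Z) * f)%g.
  by rewrite /c invgM zpowD zpowN !zpow_nat !mulgA; congr (_ * _)%g;
     rewrite -!mulgA; congr (_ * _)%g; rewrite -!zpow_nat -zpowN -!zpowD addrC.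
pose p := m%:Z - n%:Z; have p0 : p != 0 by rewrite /p; lia.
have cpow q : zpow c q%:Z = (f^-1 * zpow a (p * q%:Z) * f)%g.
  by rewrite cE -[X in (_ * _ * X)%g]invgK zpow_conj invgK -zpowM.
have Ecpow q : commensurating a (zpow c q%:Z).
  elim: q => [|q IH]; first exact: (commensurating_pow a 0).
  by rewrite -addn1 PoszD zpowD zpow1; exact: commensuratingM.
pose K2 := 3 * K + 4 * dl + tau + D 1 f.
have near q : exists j, D (zpow a (p * q%:Z)) (f * zpow a j) <= K2.
  have [j] := commensurating_near (Ecpow q); rewrite cpow => hj; exists j.
  move: hj; rewrite -(orbit_distM _ iso f) !mulgA mulgV mul1g => hj.
  have := mdist_via (act (zpow a (p * q%:Z) * f)%g o) (act (zpow a (p * q%:Z))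
    o)
    (act (f * zpow a j)%g o).
  by rewrite (orbit_distMr _ iso) /K2; move: hj; lra.
have K20 : 0 <= K2 by have [j] := near 0%N; apply: le_trans; exact: mdist_ge0.
have [B hB] := overlap_commensurating dl0 fp iso axa acyl K20.
have [j hj] := near 0%N; have [j' hj'] := near B.
by apply: hB hj hj' _; rewrite mulr0 subr0 abszM absz_nat leq_pmull// absz_gt0.
Qed.

End Translates.

(** * Overlap and divergence of translates of the axis *)

Section Translates.
Variables (R : realType) (G : groupType) (X : metricType R) (dl : R).
Hypotheses (dl0 : 0 <= dl) (fp : four_point X dl).
Variables (act : G -> X -> X) (o : X).
Hypotheses (iso : isometric_action act) (acyl : acylindrical act).
Implicit Types (f g h k : G) (i j l : int) (n m q t : nat) (x y : X).
Variables (a : G) (K : R).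
Hypothesis axa : axial act o a K.
Local Notation exc := (@excess R X).
Local Notation d := (@mdist R X).
Local Notation D g h := (mdist (act g%g o) (act h%g o)).
Local Notation E g k h := (excess (act g%g o) (act k%g o) (act h%g o)).
Local Notation tau := (D 1 a).

(** Both translates have a point at about every distance from [x] between [r] and [r'], and points
    at the same distance are close. The constant turns a gap in distance into a gap in indices. *)
Lemma translate_overlap (c : R) : 0 <= c -> exists B : R, 0 <= B /\
  forall g h x y i i' j j' (r r' : R),
    exc x (act (g * zpow a i)%g o) y <= c ->
      exc x (act (g * zpow a i')%g o) y <= c ->
    exc x (act (h * zpow a j)%g o) y <= c ->
      exc x (act (h * zpow a j')%g o) y <= c ->
    d x (act (g * zpow a i)%g o) <= r -> r' <= d x (act (g * zpow a i')%g o) ->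
    d x (act (h * zpow a j)%g o) <= r -> r' <= d x (act (h * zpow a j')%g o) ->
    r + B <= r' -> commensurating a (g^-1 * h)%g.
Proof.
move=> c0; have dl0' := dl0; have K0 := axial_ge0 axa.
have tau1 : 1 <= tau := axial_step_ge1 axa.
pose c' := 2 * tau + (K + c + dl) + dl.
have c'0 : 0 <= c' by rewrite /c'; lra.
have [B hB] := overlap_commensurating dl0 fp iso axa acyl c'0.
exists (2 * tau + B%:R * tau); split.
  by rewrite addr_ge0 ?mulr_ge0//; lra.
move=> g h x y i i' j j' r r' g1 g2 h1 h2 gr gr' hr hr' rr'.
have rler : r <= r' by have : 0 <= B%:R * tau; [rewrite mulr_ge0//|]; lra.
have pick k (l l' : int) (u : R) : exc x (act (k * zpow a l)%g o) y <= c ->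
    exc x (act (k * zpow a l')%g o) y <= c ->
    d x (act (k * zpow a l)%g o) <= u -> u <= d x (act (k * zpow a l')%g o) ->
    exists q : int, `|d x (act (k * zpow a q)%g o) - u| <= tau /\
      exc x (act (k * zpow a q)%g o) y <= K + c + dl.
  move=> k1 k2 ku ku'.
  have [] := @int_crossing _ (fun z =>
    d x (act (k * zpow a z)%g o)) tau u l l' => //.
    move=> q /=; rewrite ler_norml.
    have := mdist_via (act (k * zpow a q)%g o) x (act (k * zpow a (q + 1))%g o).
    have := mdist_via (act (k * zpow a (q + 1))%g o) x (act (k * zpow a q)%g o).
    rewrite (metric_sym (act (k * zpow a (q + 1))%g o) (act _ o)).
    by rewrite (orbit_distM _ iso) (axial_distS _ iso); lra.
  move=> q lq hq; exists q; split => //.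
  apply: (excess_convex fp k1 k2).
  by rewrite (orbit_excM _ iso); exact: (axial_between axa lq).
have meet u : r <= u <= r' -> exists z z' : int,
    [/\ `|d x (act (g * zpow a z)%g o) - u| <= tau &
        D (g * zpow a z) (h * zpow a z') <= c'].
  move=> /andP[ru ur'].
  have [q [qu q1]] := pick g i i' u g1 g2 (le_trans gr ru) (le_trans ur' gr').
  have [q' [qu' q1']] := pick h j j' u h1 h2 (le_trans hr ru) (le_trans ur'
    hr').
  exists q, q'; split=> //; apply: (excess_near fp q1 q1').
  by move: qu qu'; rewrite !ler_norml; lra.
have [q1 [q1' [d1 m1]]] := meet r (introT andP (conj (lexx _) rler)).
have [q2 [q2' [d2 m2]]] := meet r' (introT andP (conj rler (lexx _))).
apply: (hB _ q1 q1' q2 q2').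
- by rewrite -(orbit_distM _ iso g) !mulgA mulgV mul1g.
- by rewrite -(orbit_distM _ iso g) !mulgA mulgV mul1g.
- rewrite -(ler_nat R) -(ler_pM2r (lt_le_trans ltr01 tau1)).
  apply: (le_trans _ (axial_dist_pow o iso a _)); rewrite -(axial_dist _ iso).
  have := mdist_via (act (g * zpow a q1)%g o) x (act (g * zpow a q2)%g o).
  by rewrite (orbit_distM _ iso); move: d1 d2; rewrite !ler_norml; lra.
Qed.

(** If the product were large, the ray along [f] would follow the geodesic from 1 to [y] up to about
    half the excess, as the ray along [g] does, and the two translates would have a long overlap. *)
Lemma rays_diverge f g : ~ commensurating a (f^-1 * g)%g ->
  exists C : R, forall i j, E (f * zpow a i) 1 (g * zpow a j) <= C.
Proof.
move=> nc; have dl0' := dl0; have K0 := axial_ge0 axa.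
have tau1 : 1 <= tau := axial_step_ge1 axa.
have lf := mdist_ge0 (act 1%g o) (act f o).
have lg := mdist_ge0 (act 1%g o) (act g o).
pose c := K + 2 * D 1 f + 2 * D 1 g + 2 * tau + dl.
have c0 : 0 <= c by rewrite /c; lra.
have [B [B0 hB]] := translate_overlap c0.
exists (2 * (tau + D 1 f + D 1 g + B)) => i j; rewrite leNgt; apply/negP => big.
set x := act (f * zpow a i)%g o in big *.
set y := act (g * zpow a j)%g o in big *; set e := exc x (act 1%g o) y in big.
have ex : e <= 2 * d (act 1%g o) x.
  have := mdist_via (act 1%g o) x y; have := mdist_via x (act 1%g o) y.
  by rewrite /e /excess (metric_sym x (act 1%g o)); lra.
have ey : e <= 2 * d (act 1%g o) y.
  have := mdist_via y (act 1%g o) x; have := mdist_via y x (act 1%g o).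
  by rewrite /e /excess (metric_sym x (act 1%g o)) (metric_sym y); lra.
have cst k : E 1 (k * zpow a 0) k = 0 by rewrite zpow0 mulg1 excess_right.
have [] := @int_crossing _ (fun z =>
  d (act 1%g o) (act (f * zpow a z)%g o)) tau (e / 2) 0 i.
- move=> q /=; rewrite ler_norml.
  have := mdist_via (act (f * zpow a q)%g o) (act 1%g o) (act (f * zpow a (q +
    1))%g o).
  have := mdist_via (act (f * zpow a (q + 1))%g o) (act 1%g o) (act (f * zpow a
    q)%g o).
  rewrite (metric_sym (act (f * zpow a (q + 1))%g o) (act (f * _)%g o)).
  by rewrite (orbit_distM _ iso) (axial_distS _ iso); lra.
- by rewrite zpow0 mulg1; lra.
- by rewrite -/x; lra.
move=> q qi; rewrite ler_norml => /andP[q1 q2].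
have near_f : exc (act 1%g o) (act (f * zpow a q)%g o) y <= c.
  have h : E 1 (f * zpow a q) (f * zpow a i) <= K + 2 * D 1 f.
    have := excess_endl (act f o) (act 1%g o) (act (f * zpow a q)%g o) (act (f
      * zpow a i)%g o).
    have : E f (f * zpow a q) (f * zpow a i) <= K.
      rewrite -[X in E X _ _]mulg1 (orbit_excM _ iso) -(zpow0 a).
      exact: (axial_between axa qi).
    by rewrite (metric_sym (act f o)); lra.
  have -> : c = (K + 2 * D 1 f + 2 * D 1 g + 2 * tau) + dl by rewrite /c; lra.
  apply: (@excess_fellow _ _ _ fp _ _ _ _ _ (2 * tau) _ h) => //.
  - rewrite -/x -/e; lra.
  - lra.
  - lra.
apply: nc; apply: (hB f g (act 1%g o) y 0 q 0 j (D 1 f + D 1 g) (e / 2 - tau)).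
- have := excess_center (act 1%g o) y (act 1%g o) (act f o).
  by rewrite excess_left zpow0 mulg1 /c; lra.
- exact: near_f.
- have := excess_center (act 1%g o) y (act 1%g o) (act g o).
  by rewrite excess_left zpow0 mulg1 /c; lra.
- by rewrite excess_right.
- by rewrite zpow0 mulg1; lra.
- by lra.
- by rewrite zpow0 mulg1; lra.
- by rewrite -/y; lra.
- by lra.
Qed.

End Translates.

(** * Schottky families *)

Lemma reduced_nth k (w : seq ('I_k * bool)) l n : reduced w ->
  (n.+1 < size w)%N -> nth l w n.+1 != linv (nth l w n).
Proof.
case: w => // l' w; rewrite /reduced /= => /(pathP l) h; rewrite ltnS => nw.
exact: h.
Qed.

Lemma word_eval_conj (G : groupType) k (g : G) (v : 'I_k ->
  G) (w : freegroup k) :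
  word_eval (fun i => g * v i * g^-1)%g w = (g * word_eval v w * g^-1)%g.
Proof.
rewrite /word_eval; elim: (fgword w) => [|l s IH].
  by rewrite !big_nil mulg1 mulgV.
rewrite !big_cons IH /letter_eval; case: l.2;
  by rewrite ?invgM ?invgK !mulgA mulgVK.
Qed.

Section Schottky.
Variables (R : realType) (G : groupType) (X : metricType R) (dl : R).
Hypotheses (dl0 : 0 <= dl) (fp : four_point X dl).
Variables (act : G -> X -> X) (o : X).
Hypotheses (iso : isometric_action act) (acyl : acylindrical act).
Implicit Types (g h : G) (i j l : int) (n m q t : nat).
Variables (a : G) (K : R).
Hypothesis axa : axial act o a K.
Local Notation exc := (@excess R X).
Local Notation d := (@mdist R X).
Local Notation D g h := (mdist (act g%g o) (act h%g o)).
Local Notation E g k h := (excess (act g%g o) (act k%g o) (act h%g o)).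

Lemma conj_far g i : (`|i|%N)%:R - 2 * D 1 g <= D 1 (g * zpow a i * g^-1).
Proof.
case: axa => _ /(_ i).
have := mdist_via (act (g * zpow a i * g^-1)%g o) (act g o) (act (g * zpow a
  i)%g o).
have := mdist_via (act 1%g o) (act g o) (act (g * zpow a i * g^-1)%g o).
rewrite (metric_sym (act (g * _ * _)%g o)) !(orbit_distMr _ iso) (orbit_distV _
  iso).
by rewrite (metric_sym (act g o) (act 1%g o)); lra.
Qed.

Lemma conj_excess g h i j :
  E (g * zpow a i * g^-1) 1 (h * zpow a j * h^-1) <=
  E (g * zpow a i) 1 (h * zpow a j) + 2 * D 1 g + 2 * D 1 h.
Proof.
have := excess_end (act (g * zpow a i * g^-1)%g o) (act 1%g o)
  (act (h * zpow a j)%g o) (act (h * zpow a j * h^-1)%g o).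
have := excess_endl (act (g * zpow a i)%g o) (act (g * zpow a i * g^-1)%g o)
  (act 1%g o) (act (h * zpow a j)%g o).
by rewrite !(orbit_distMr _ iso) !(orbit_distV _ iso); lra.
Qed.

(** Distinct indices give diverging rays. For equal indices the sign condition says that the two
    rays leave along the same axis in opposite directions, where [axial] bounds the corner. The
    bound is uniform in the exponents. *)
Lemma conj_diverge (I : finType) (f : I -> G) :
  (forall x y, x != y -> ~ commensurating a ((f x)^-1 * f y)%g) ->
  exists2 C : R, 0 <= C & forall x y i j,
    (x != y) || ((0 <= i) && (j <= 0)) || ((i <= 0) && (0 <= j)) ->
    E (f x * zpow a i * (f x)^-1) 1 (f y * zpow a j * (f y)^-1) <= C.
Proof.
move=> nc.
have pair p : exists C : R, forall i j,
    (p.1 != p.2) || ((0 <= i) && (j <= 0)) || ((i <= 0) && (0 <= j)) ->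
    E (f p.1 * zpow a i * (f p.1)^-1) 1 (f p.2 * zpow a j * (f p.2)^-1) <= C.
  case: p => x y /=; have [<-|xy] := eqVneq x y.
    exists (K + 6 * D 1 (f x)) => i j ij.
    apply: le_trans (conj_excess _ _ _ _) _.
    have : E (f x * zpow a i) (f x) (f x * zpow a j) <= K.
      rewrite -[X in E _ X _]mulg1 (orbit_excM _ iso) -(zpow0 a).
      by apply: (axial_between axa); move: ij;
        rewrite /= => /orP[]/andP[-> ->]; rewrite ?orbT.
    have := excess_center (act (f x * zpow a i)%g o) (act (f x * zpow a j)%g o)
      (act (f x) o) (act 1%g o).
    by rewrite (metric_sym (act (f x) o) (act 1%g o)); lra.
  have [C hC] := rays_diverge dl0 fp iso acyl axa (nc _ _ xy).
  exists (C + 2 * D 1 (f x) + 2 * D 1 (f y)) => i j _.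
  by apply: le_trans (conj_excess _ _ _ _) _; have := hC i j; lra.
have [C hC] := choice pair.
exists (\sum_p `|C p|); first by apply: sumr_ge0.
move=> x y i j xy; apply: le_trans (hC (x, y) i j xy) _.
apply: le_trans (ler_norm _) _; rewrite (bigD1 (x, y))//= lerDl.
by apply: sumr_ge0.
Qed.

Lemma conj_long (I : finType) (f : I -> G) (L : R) :
  exists N, forall x i, (N <= `|i|)%N -> L <= D 1 (f x * zpow a i * (f x)^-1).
Proof.
exists (Num.bound (`|L| + \sum_x 2 * D 1 (f x))) => x i Ni.
apply: le_trans (conj_far _ _).
have h : `|L| + \sum_x 2 * D 1 (f x) < (`|i|%N)%:R.
  apply: lt_le_trans (archi_boundP _) _; last by rewrite ler_nat.
  by rewrite addr_ge0// sumr_ge0// => y _; rewrite mulr_ge0// mdist_ge0.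
have : 2 * D 1 (f x) <= \sum_x 2 * D 1 (f x).
  rewrite [leRHS](bigD1 x)//= lerDl sumr_ge0// => y _.
  by rewrite mulr_ge0// mdist_ge0.
by have := ler_norm L; lra.
Qed.

(* Using disjoint sets of generators for the two factors makes the product
   cyclically reduced. *)
Lemma exists_axial_value f k (w : freegroup k) : ~ commensurating a f ->
  w <> 1%g -> exists v v' K', axial act o (word_eval v w * word_eval v' w)%g K'.
Proof.
move=> nf w1; have dl0' := dl0.
pose q := size w; have q0 : (0 < q)%N.
  rewrite lt0n; apply/negP => /nilP w0; apply: w1; apply: val_inj; exact: w0.
pose idx (x : bool * 'I_k) := (x.1 * k + x.2)%N.
have idx_inj x y : x != y -> idx x != idx y.
  case: x y => [b i] [b' i']; apply: contra_neq; rewrite /idx /= => h.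
  have := ltn_ord i; have := ltn_ord i' => h1 h2.
  have [bb ii] : b = b' /\ i = i' :> nat.
    by move: h; case: b; case: b'; rewrite ?mul1n ?mul0n => h; split; lia.
  by rewrite bb (val_inj ii).
pose F x := (a ^+ idx x * f)%g.
have [C C0 hC] := @conj_diverge _ F
  (fun x y xy => exists_translates dl0 fp iso acyl axa nf (idx_inj x y xy)).
pose L := 2 * C + 3 * dl + 1.
have [N hN] := conj_long F L.
pose ltr (b : bool) (x : 'I_k * bool) : G :=
  (F (b, x.1) * zpow a (if x.2 then - N%:Z else N%:Z) * (F (b, x.1))^-1)%g.
pose v b (r : 'I_k) := (F (b, r) * zpow a N%:Z * (F (b, r))^-1)%g.
have ltrE b x : letter_eval (v b) x = ltr b x.
  rewrite /letter_eval /ltr /v; case: x.2 => //.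
  by rewrite invg_conj -zpowN.
have [l0 _] : exists l0 : 'I_k * bool, l0 \in (w : seq _).
  by move: q0; rewrite /q; case: (fgword w) => // l s _; exists l;
    rewrite mem_head.
(* The two values of [w] form one sequence of period 2q; the parity of n / q tells which set of
   generators is in use. *)
pose e n := ltr (odd (n %/ q)) (nth l0 w (n %% q)).
have eV n : ((e n)^-1)%g = ltr (odd (n %/ q)) (linv (nth l0 w (n %% q))).
  rewrite /e /ltr /=; case: (nth _ _ _) => i [] /=;
  by rewrite invg_conj -zpowN ?opprK.
exists (v false), (v true), (C + 2 * dl).
have -> : (word_eval (v false) w * word_eval (v true) w = partial_prod e (q +
  q))%g.
  rewrite partial_prodS /word_eval; congr (_ * _)%g.
    rewrite -(partial_prod_nth _ l0); apply: eq_partial_prod => n nq;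
      rewrite ltrE /e.
    by rewrite divn_small// modn_small.
  rewrite -(partial_prod_nth _ l0); apply: eq_partial_prod => n nq;
    rewrite ltrE /e.
  by rewrite divnDl// divnn q0 divn_small// modnDl modn_small.
apply: (@periodic_axial _ _ _ _ dl0 fp _ _ iso _ _ C L) => //.
- by rewrite /L; lra.
- by rewrite /L; lra.
- by rewrite addn_gt0 q0.
- move=> n; rewrite /e -addnA divnDl// divnDl// divnn q0 !modnDl.
  by rewrite !add1n /= negbK.
- by move=> n; apply: hN; case: ifP; rewrite ?abszN absz_nat.
- move=> n; rewrite eV /e /ltr; apply: hC.
  (* Inside a copy of [w] reducedness excludes backtracking; at the junction of two copies the
     conjugating elements differ. *)
  have [nq|nq] := ltnP (n %% q).+1 q.
  + have nE : n.+1 = (n %/ q * q + (n %% q).+1)%N by rewrite addnS -divn_eq.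
    rewrite nE divnMDl// (divn_small nq) addn0 modnMDl (modn_small nq).
    have := reduced_nth l0 (fgwordP w) nq.
    case: (nth l0 w _.+1) => i' b'; case: (nth l0 w _) => i b.
    rewrite /linv /= xpair_eqE negb_and => /orP[ii|].
      by rewrite xpair_eqE eqxx /= eq_sym ii.
    case: b b' => [] [] //= _;
      by rewrite ?lez_nat ?oppr_le0 ?lez_nat /= ?orbT.
  + have nq' : (n %% q).+1 = q by apply/eqP; rewrite eqn_leq nq ltn_mod q0.
    have nE : n.+1 = ((n %/ q).+1 * q)%N.
      by rewrite {1}(divn_eq n q) -addnS nq' mulSn addnC.
    rewrite nE mulnK// /= xpair_eqE.
    by case: (odd _).
Qed.

End Schottky.

(** * The chain quasimorphism *)

Section Chains.
Variables (R : realType) (G : groupType) (X : metricType R) (dl : R).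
Hypotheses (dl0 : 0 <= dl) (fp : four_point X dl) (geo : geodesic_space X).
Variables (act : G -> X -> X) (o : X).
Hypothesis iso : isometric_action act.
Variables (sigma : G) (W : R).
Local Notation exc := (@excess R X).
Local Notation d := (@mdist R X).
Local Notation D g h := (mdist (act g%g o) (act h%g o)).
Local Notation ell := (D 1 sigma).
Local Notation C := (2 * W + 1).
(** [long] is the length condition for broken geodesics with corners of excess at most [C] and edges
    of length at least [ell - W - 1], the bounds that a nearly optimal chain satisfies. *)
Hypotheses (W0 : 0 <= W) (long : 4 * W + 2 + 3 * dl < 2 * (ell - W - 1)).
Implicit Types (x y z m : X) (g h : G) (s : seq G).

Local Notation tip g := (act (g%g * sigma)%g o).

(* Length of the path from [x] to [y] along the translates by [s] of the jump
   from [o] to [sigma o], each jump being discounted by [W]. *)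
Fixpoint cost x s y : R :=
  if s is g :: s' then d x (act g o) + (ell - W) + cost (tip g) s' y else d x y.

Definition chain_end x s := last x [seq tip g | g <- s].

Lemma cost_ge0 x s y : 0 <= cost x s y.
Proof.
elim: s x => [|g s IH] x /=; first exact: mdist_ge0.
have := IH (tip g); have := mdist_ge0 x (act g o).
by move: long W0 dl0; lra.
Qed.

Lemma cost_left x x' s y : cost x s y <= d x x' + cost x' s y.
Proof.
case: s => [|g s] /=; first exact: mdist_via.
by have := mdist_via x' x (act g o); lra.
Qed.

Lemma cost_right x s y y' : cost x s y' <= cost x s y + d y y'.
Proof.
by elim: s x => [|g s IH] x /=; [exact: mdist_via|have := IH (tip g); lra].
Qed.

Lemma cost_cat x s s' y :
  cost x (s ++ s') y = cost x s (chain_end x s) + cost (chain_end x s) s' y.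
Proof.
elim: s x => [|g s IH] x /=; first by rewrite /chain_end /= mdistxx add0r.
by rewrite IH !addrA.
Qed.

Lemma cost_cat_le x s m s' y : cost x (s ++ s') y <= cost x s m + cost m s' y.
Proof.
elim: s x => [|g s IH] x /=; first exact: cost_left.
by have := IH (tip g); lra.
Qed.

Lemma cost_act h x s y :
  cost (act h x) [seq (h * g)%g | g <- s] (act h y) = cost x s y.
Proof.
have isod : forall k u v, d (act k u) (act k v) = d u v by case: iso.
elim: s x => [|g s IH] x /=; first exact: isod.
by rewrite -mulgA !(actM iso) isod IH.
Qed.

Definition chain_dist x y : R := inf [set cost x s y | s in [set: seq G]].
Local Notation rho := chain_dist.

Lemma has_inf_cost x y : has_inf [set cost x s y | s in [set: seq G]].
Proof.
split; first by exists (cost x [::] y), [::].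
by exists 0 => _ [s _ <-]; exact: cost_ge0.
Qed.

Lemma chain_dist_le x s y : rho x y <= cost x s y.
Proof. by apply: ge_inf; [case: (has_inf_cost x y)|exists s]. Qed.

Lemma chain_dist_approx x y : exists s, cost x s y < rho x y + 1.
Proof.
by have [_ [s _ <-]] := inf_adherent ltr01 (has_inf_cost x y); exists s.
Qed.

Lemma chain_dist_act h x y : rho (act h x) (act h y) = rho x y.
Proof.
have le k u v : rho (act k u) (act k v) <= rho u v.
  apply: lb_le_inf; first by case: (has_inf_cost u v).
  by move=> _ [s _ <-]; rewrite -(cost_act k); exact: chain_dist_le.
apply/eqP; rewrite eq_le le /=; have := le h^-1%g (act h x) (act h y).
by rewrite -!(actM iso) mulVg !(act1 iso).
Qed.

Lemma chain_dist_via m x y : rho x y <= rho x m + rho m y + 2.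
Proof.
have [s hs] := chain_dist_approx x m; have [s' hs'] := chain_dist_approx m y.
have := chain_dist_le x (s ++ s') y; have := cost_cat_le x s m s' y; lra.
Qed.

(** * Nearly optimal chains are broken geodesics *)

Section OptimalChain.
Variables (x y : X) (s : seq G).
Hypothesis opt : forall s', cost x s y <= cost x s' y + 1.

(** The starting points of the jumps are not taken as vertices: the way from a tip to the next start
    may be short, whereas an edge from tip to tip contains a jump. *)
Let T (i : nat) := nth y (x :: [seq tip g | g <- s]) i.

Let T_tip i : (i < size s)%N -> T i.+1 = tip (nth 1%g s i).
Proof. by move=> si; rewrite /T /= (nth_map 1%g). Qed.

Let T_last : T (size s).+1 = y.
Proof. by rewrite /T nth_default//= size_map. Qed.

Let T_end i : (i <= size s)%N -> chain_end x (take i s) = T i.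
Proof.
move=> si; rewrite /chain_end (last_nth y) size_map size_takel//.
by rewrite map_take /T; case: i si => // i si /=; rewrite nth_take.
Qed.

Let split_opt i s' : (i <= size s)%N ->
  cost (T i) (drop i s) y <= cost (T i) s' y + 1.
Proof.
move=> si; rewrite -(T_end si); have := opt (take i s ++ s').
by rewrite -{1}(cat_take_drop i s) !cost_cat; lra.
Qed.

Let jump_opt i : (i < size s)%N ->
  d (T i) (act (nth 1%g s i) o) + ell - W <= d (T i) (T i.+1) + 1.
Proof.
move=> si; have := split_opt (drop i.+1 s) (ltnW si).
rewrite (drop_nth 1%g si) /= T_tip//.
by have := cost_left (T i) (tip (nth 1%g s i)) (drop i.+1 s) y; lra.
Qed.

Let edge_opt i : (i.+1 < (size s).+1)%N -> ell - W - 1 <= d (T i) (T i.+1).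
Proof.
by move=> si; have := jump_opt si;
  have := mdist_ge0 (T i) (act (nth 1%g s i) o); lra.
Qed.

Let jump_le i : (i < size s)%N ->
  d (T i) (T i.+1) <= d (T i) (act (nth 1%g s i) o) + ell.
Proof.
move=> si; have := mdist_via (act (nth 1%g s i) o) (T i) (T i.+1).
by rewrite T_tip// (orbit_distMr _ iso).
Qed.

(** Comparison with the chain from which the jumps on both sides of the corner are dropped: each of
    them saves at most [W], and optimality holds up to 1. *)
Let corner_opt i : (i.+1 < (size s).+1)%N -> exc (T i) (T i.+1) (T i.+2) <= C.
Proof.
rewrite ltnS => si; have := jump_le si.
rewrite /excess; move: (si); rewrite leq_eqVlt => /predU1P[si1|si1].
- rewrite si1 T_last; have := split_opt [::] (ltnW si).
  rewrite (drop_nth 1%g si) si1 drop_size /= -T_tip// si1; move: W0; lra.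
- have := jump_le si1; have := split_opt (drop i.+2 s) (ltnW si).
  rewrite (drop_nth 1%g si) /= (drop_nth 1%g si1) /= -!T_tip//.
  by have := cost_left (T i) (T i.+2) (drop i.+2 s) y; lra.
Qed.

Let middle_opt i j k : (i <= j)%N -> (j <= k)%N -> (k <= (size s).+1)%N ->
  exc (T i) (T j) (T k) <= C + 2 * dl.
Proof.
apply: (broken_middle dl0 fp edge_opt corner_opt); last by move: long; lra.
by move: W0; lra.
Qed.

(** Comparison with the chain without the jump puts [act g o] within excess W + 1 of its edge; the
    rest of the error is that of a broken geodesic. The last bound says that jumps are made
    forwards. *)
Lemma jump_position g : g \in s ->
  [/\ exc x (act g o) y <= 3 * W + 3 * dl + 2,
      exc x (tip g) y <= 3 * W + 3 * dl + 2 &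
      d x (act g o) + ell <= d x (tip g) + (3 * W + 2 * dl + 2)].
Proof.
move=> /(nthP 1%g)[i si <-].
have i1 : (i <= (size s).+1)%N by apply: leq_trans (ltnW si) _.
have := middle_opt (leq0n i) i1 (leqnn _);
  have := middle_opt (leq0n i.+1) (leqW si) (leqnn _).
have := middle_opt (leq0n i) (leqnSn i) (leqW si).
have -> : T 0%N = x by []. rewrite T_last => h1 h2 h3;
  have := jump_opt si => h4.
have h5 := mdist_via (T i) x (act (nth 1%g s i) o).
rewrite -T_tip//; split.
- have -> : 3 * W + 3 * dl + 2 = (W + 1) + (C + 2 * dl) + dl by lra.
  apply: (excess_convex fp h3 h2).
  by rewrite /excess T_tip// (orbit_distMr _ iso) -T_tip//; lra.
- by move: W0 dl0; lra.
- by move: h1; rewrite /excess; lra.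
Qed.

(** The chain is cut on an edge passing near [m]. If that edge contains a jump, the jump is given up
    at the price of its discount [W]. *)
Lemma opt_split m c : exc x m y <= c ->
  rho x m + rho m y <= cost x s y + W + c + 2 * (C + 2 * dl + dl).
Proof.
move=> xm.
have [] := @excess_path_edge _ _ _ dl0 fp T (size s).+1 (C + 2 * dl) c m.
- by [].
- by move=> j jM; apply: middle_opt.
- by move: W0 dl0; lra.
- by rewrite T_last.
move=> i; rewrite ltnS => si; rewrite /excess => hi.
have := chain_dist_le x (take i s) m.
have := cost_right x (take i s) (T i) m.
move: si; rewrite leq_eqVlt => /predU1P[si|si].
- have := chain_dist_le m [::] y; move: hi; rewrite si T_last /=.
  have := cost_cat x (take i s) [::] y; rewrite cats0 T_end ?si//= take_size.
  by move: W0; lra.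
- have := cost_cat x (take i s) (drop i s) y;
    rewrite cat_take_drop T_end ?(ltnW si)//.
  rewrite (drop_nth 1%g si) /= -T_tip//.
  have := jump_le si; have := chain_dist_le m (drop i.+1 s) y.
  have := cost_left m (T i.+1) (drop i.+1 s) y.
  by move: hi; lra.
Qed.

End OptimalChain.

Lemma chain_dist_opt x y : exists s,
  cost x s y <= rho x y + 1 /\ forall s', cost x s y <= cost x s' y + 1.
Proof.
have [s hs] := chain_dist_approx x y; exists s; split; first exact: ltW.
by move=> s'; have := chain_dist_le x s' y; lra.
Qed.

Lemma chain_dist_split x y m c : exc x m y <= c ->
  rho x m + rho m y <= rho x y + (W + 1 + c + 2 * (C + 2 * dl + dl)).
Proof.
move=> xm; have [s [s1 s2]] := chain_dist_opt x y.
by have := opt_split s2 xm; lra.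
Qed.

Lemma exists_center x y z : exists m,
  [/\ exc x m y <= dl, exc y m z <= dl & exc x m z <= dl].
Proof.
have [S gS] := geo x y; have split := geodesic_split gS.
case: gS split => c [c0 cD ciso ->] split.
(* The Gromov product of [y] and [z] based at [x]: where a tripod with these side lengths
   branches. *)
pose u := (d x y + d x z - d y z) / 2.
have u0 : 0 <= u.
  by have := mdist_via x y z; rewrite /u (metric_sym y x); lra.
have u1 : u <= d x y.
  by have := mdist_via y x z; rewrite /u; lra.
have uD : u \in `[0, d x y] by rewrite in_itv /= u0 u1.
have Su : (c @` `[0, d x y]) (c u) by exists u.
have xu : d x (c u) = u.
  rewrite -[x]c0 ciso// ?in_itv/= ?lexx ?mdist_ge0// sub0r normrN ger0_norm//.
have yu := split _ Su; exists (c u).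
have := fp z x (c u) y; move: yu xu; rewrite /excess /u.
have := metric_sym z x; have := metric_sym z y; have := metric_sym z (c u).
have := metric_sym y (c u); have := dl0.
by move=> *; split; lra.
Qed.

Definition chain_qm g : R := rho (act g o) (act 1%g o) - rho (act 1%g o) (act g
  o).

Lemma chain_qmV g : chain_qm g^-1 = - chain_qm g.
Proof.
rewrite /chain_qm -(chain_dist_act g) -(chain_dist_act g _ (act g^-1 o)).
by rewrite -!(actM iso) mulgV mulg1; lra.
Qed.

(** By invariance the defect is a signed sum of [rho] over the triangle 1, g, gh in both
    orientations. Splitting every term at the centre makes all contributions cancel, although [rho]
    is not symmetric. *)
Lemma chain_qm_defect : exists B : R, forall g h,
  `|chain_qm (g * h)%g - chain_qm g - chain_qm h| <= B.
Proof.
pose B := W + 1 + dl + 2 * (C + 2 * dl + dl) + 2.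
exists (6 * B) => g h; have -> : chain_qm h = rho (act (g * h)%g o) (act g o) -
    rho (act g o) (act (g * h)%g o).
  by rewrite /chain_qm -(chain_dist_act g) -[X in _ - X](chain_dist_act g)
    -!(actM iso) mulg1.
have [m [m1 m2 m3]] := exists_center (act 1%g o) (act g o) (act (g * h)%g o).
have near x y : exc x m y <= dl -> `|rho x m + rho m y - rho x y| <= B.
  move=> xm; have := chain_dist_split xm; have := chain_dist_via m x y.
  have := W0; have := dl0; rewrite ler_norml /B; lra.
have := near _ _ m1; have := near _ _ m2; have := near _ _ m3.
rewrite excess_sym in m1; rewrite excess_sym in m2; rewrite excess_sym in m3.
have := near _ _ m1; have := near _ _ m2; have := near _ _ m3.
rewrite /chain_qm !ler_norml =>
  /andP[? ?] /andP[? ?] /andP[? ?] /andP[? ?] /andP[? ?] /andP[? ?].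
by apply/andP; split; lra.
Qed.

End Chains.

(** * A word that cannot be reversed *)

(* Positions along a geodesic: the marks [p t] separate the syllables of a
   periodic word, whose lengths [la 0], [la 1], [la 2] are far apart.  A segment
   [b2, b1] of length about [la 1], followed by a segment [b1,
     b0] of length about
   [la 0], cannot be placed there, since [b2, b1] has to match a syllable of
   length [la 1] and the next one has length [la 2] < [la 0]. *)
Lemma no_reversal (R : realType) (p la : nat ->
  R) (M : nat) (b0 b1 b2 ga c c' : R)
    (S1 S2 : nat -> Prop) :
  0 <= ga -> 0 <= c -> 0 <= c' ->
  3 * ga + 2 * c + c' + 1 <= la 2%N ->
    la 2%N + (3 * ga + 2 * c + c' + 1) <= la 0%N ->
  la 0%N + (3 * ga + 2 * c + c' + 1) <= la 1%N -> p 0%N = 0 ->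
  (forall t, (t < M)%N ->
    p t + la (t %% 3)%N - c <= p t.+1 <= p t + la (t %% 3)%N) ->
  0 <= b2 -> b2 + la 1%N - c <= b1 -> b1 + la 0%N - c <= b0 -> b0 <= p M + c' ->
  (forall t, (t < M)%N -> b1 + ga <= b0 -> b1 + ga <= p t.+1 ->
    p t + ga <= b0 ->
     p t + ga <= p t.+1 -> S1 t) ->
  (forall t, (t < M)%N -> b2 + ga <= b1 -> b2 + ga <= p t.+1 ->
    p t + ga <= b1 ->
     p t + ga <= p t.+1 -> S2 t) ->
  (forall t, S1 t -> ~ S1 t.+1) -> (forall t, S2 t -> ~ S2 t.+1) ->
  (forall t, S1 t -> ~ S2 t) -> False.
Proof.
move=> ga0 c0 c0' l2 l20 l01 p0 pS b20 b21 b10 b0M ov1 ov2 n1 n2 n12.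
have lamin t : la 2%N <= la (t %% 3)%N.
  by case: (t %% 3)%N (ltn_pmod t (isT : 0 < 3)%N) => [|[|[|]]] // _; lra.
have edge t : (t < M)%N -> p t + 2 * ga <= p t.+1.
  by move=> tM; have /andP[] := pS t tM; have := lamin t; lra.
have type1 t e : e <= 2 * ga -> la 1%N - c <= la (t %% 3)%N + e ->
  (t.+1 %% 3 = 2)%N.
  move=> he; rewrite -[t.+1]addn1 -modnDml.
  by case: (t %% 3)%N (ltn_pmod t (isT : 0 < 3)%N) => [|[|[|]]] // _ *;
    exfalso; lra.
(* Otherwise the preceding syllable would match [b2, b1] too, against [n2]. *)
have start t : (t < M)%N -> p t <= b1 -> S2 t -> p t - ga <= b2.
  case: t => [|t] tM tb st; first by rewrite p0; lra.
  rewrite leNgt; apply/negP => h.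
  have et := edge t (ltnW tM).
  by apply: (n2 t _ st); apply: ov2; rewrite ?(ltnW tM)//; lra.
have [] := @nat_switch (fun t => p t <= b1) M.
- by rewrite p0; lra.
- by move: b0M; lra.
move=> k [kM pk /negP]; rewrite -ltNge => pk1.
(* After a mark near [b1] at the end of a syllable of length [la 1] comes one of length [la 2], too
   short to cover [b1, b0]; it and its successor then both match that segment, against [n1]. *)
suff [ka [kaM ka3 kal kau]] : exists ka, [/\ (ka <= M)%N, (ka %% 3 = 2)%N,
    p ka - ga <= b1 & b1 <= p ka + ga].
  have {}kaM : (ka < M)%N.
    rewrite ltn_neqAle kaM andbT; apply/eqP => kE; move: kal b0M; rewrite -kE.
    by lra.
  have eka := edge ka kaM; have /andP[pl pu] := pS ka kaM.
  rewrite ka3 in pl pu.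
  have kaM1 : (ka.+1 < M)%N.
    rewrite ltn_neqAle kaM andbT; apply/eqP => kE; move: kal b0M; rewrite -kE.
    by lra.
  have eka1 := edge ka.+1 kaM1.
  by apply: (n1 ka); apply: ov1 => //; lra.
have ek := edge k kM; have /andP[pl pu] := pS k kM.
have [h|h] := leP (p k + ga) b1.
- have s2 : S2 k by apply: ov2 => //; lra.
  have := start k kM pk s2 => hs.
  have hb : p k.+1 < b1 + ga.
    rewrite ltNge; apply/negP => hb; apply: (n12 k _ s2).
    by apply: ov1 => //; lra.
  by exists k.+1; split => //; [apply: (@type1 k ga)|..]; lra.
- case: k kM pk pk1 ek pl pu h => [|j] jM pj _ _ _ _ h.
    by exfalso; move: h; rewrite p0; lra.
  have ej := edge j (ltnW jM); have /andP[pl pu] := pS j (ltnW jM).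
  have s2 : S2 j by apply: ov2; rewrite ?(ltnW jM)//; lra.
  have pjb : p j <= b1 by lra.
  have hs := start j (ltnW jM) pjb s2.
  exists j.+1; split; [exact: ltnW|apply: (@type1 j (2 * ga))|..]; lra.
Qed.

(** * Linear growth of the quasimorphism *)

Section Irreversible.
Variables (R : realType) (G : groupType) (X : metricType R) (dl : R).
Hypotheses (dl0 : 0 <= dl) (fp : four_point X dl) (geo : geodesic_space X).
Variables (act : G -> X -> X) (o : X).
Hypotheses (iso : isometric_action act) (acyl : acylindrical act).
Variables (a : G) (K : R).
Hypothesis axa : axial act o a K.
Implicit Types (g h : G) (n m r : nat).
Local Notation exc := (@excess R X).
Local Notation d := (@mdist R X).
Local Notation D g h := (mdist (act g%g o) (act h%g o)).
Local Notation E g k h := (excess (act g%g o) (act k%g o) (act h%g o)).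

(* The overlap criterion in terms of the positions [l, u] and [l', u'] of two
   segments, given up to an error F. *)
Lemma segment_overlap (c F : R) : 0 <= c -> 0 <= F -> exists2 Ga : R, 0 <= Ga &
  forall g h x y z z' t t' (i i' j j' : int),
    exc x z y <= c -> exc x z' y <= c -> exc x t y <= c -> exc x t' y <= c ->
    d z (act (g * zpow a i)%g o) <= F -> d z' (act (g * zpow a i')%g o) <= F ->
    d t (act (h * zpow a j)%g o) <= F -> d t' (act (h * zpow a j')%g o) <= F ->
    d x z + Ga <= d x z' -> d x z + Ga <= d x t' ->
    d x t + Ga <= d x z' -> d x t + Ga <= d x t' ->
      commensurating a (g^-1 * h)%g.
Proof.
move=> c0 F0; have cF : 0 <= c + 2 * F by lra.
have [B [B0 hB]] := translate_overlap dl0 fp iso acyl axa cF.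
exists (B + 2 * F); first lra.
move=> g h x y z z' t t' i i' j j' e1 e2 e3 e4 d1 d2 d3 d4 h1 h2 h3 h4.
have near u v : exc x u y <= c -> d u v <= F -> exc x v y <= c + 2 * F.
  by move=> ? ?; have := excess_center x y u v; lra.
have pos u v : d u v <= F -> d x v <= d x u + F /\ d x u - F <= d x v.
  move=> ?; have := mdist_via u x v; have := mdist_via v x u.
  by rewrite (metric_sym v u); lra.
have [p1 p2] := pos _ _ d1; have [p3 p4] := pos _ _ d2.
have [p5 p6] := pos _ _ d3; have [p7 p8] := pos _ _ d4.
have mx := le_max (d x z) (d x z) (d x t);
  have mx' := le_max (d x t) (d x z) (d x t).
have mn := ge_min (d x z') (d x z') (d x t');
  have mn' := ge_min (d x t') (d x z') (d x t').
rewrite !lexx ?orbT /= in mx mx' mn mn'.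
apply: (hB g h x y i i' j j' (Num.max (d x z) (d x t) + F) (Num.min (d x z') (d
  x t') - F)).
- exact: near e1 d1.
- exact: near e2 d2.
- exact: near e3 d3.
- exact: near e4 d4.
- by move: mx; set mm := Num.max _ _; lra.
- by move: mn; set mm := Num.min _ _; lra.
- by move: mx'; set mm := Num.max _ _; lra.
- by move: mn'; set mm := Num.min _ _; lra.
- suff : Num.max (d x z) (d x t) + (B + 2 * F) <= Num.min (d x z') (d x t').
    by set mm := Num.max _ _; set mm' := Num.min _ _; lra.
  by rewrite -lerBrDr ge_max !lerBrDr !le_min h1 h2 h3 h4.
Qed.

Variables (F : nat -> G) (N : nat -> nat) (C : R).
Let e t := (F (t %% 3) * zpow a (N (t %% 3))%:Z * (F (t %% 3))^-1)%g.
Let la r := D 1 (F r * zpow a (N r)%:Z * (F r)^-1).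
Let P t := partial_prod e t.
Let sigma := P 2.
Local Notation C1 := (C + 2 * dl).
(** The discount exceeds by 1 what the three corners of a period can cost. [c1] and [c2] are the
    errors in [jump_position], and [c5] is what convexity yields at the vertex between the two
    syllables of a jump. *)
Let W := 3 * C1 + 1.
Let c1 := 3 * W + 3 * dl + 2.
Let c2 := 3 * W + 2 * dl + 2.
Let c4 := C1 + c1 + c2.
Let c5 := C1 + c1 + dl.
Variables (Fl Ga : R).
Hypotheses (C0 : 0 <= C)
  (eC : forall t, E (e t)^-1 1 (e t.+1) <= C)
  (Fnc : forall t, ~ commensurating a ((F (t %% 3))^-1 * F (t.+1 %% 3))%g)
  (FFl : forall t, D 1 (F (t %% 3)) <= Fl)
  (Ga0 : 0 <= Ga)
  (over : forall g h x y z z' t t' (i i' j j' : int),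
    exc x z y <= c5 -> exc x z' y <= c5 -> exc x t y <= c5 ->
      exc x t' y <= c5 ->
    d z (act (g * zpow a i)%g o) <= Fl ->
      d z' (act (g * zpow a i')%g o) <= Fl ->
    d t (act (h * zpow a j)%g o) <= Fl ->
      d t' (act (h * zpow a j')%g o) <= Fl ->
    d x z + Ga <= d x z' -> d x z + Ga <= d x t' ->
    d x t + Ga <= d x z' -> d x t + Ga <= d x t' ->
      commensurating a (g^-1 * h)%g).
(** The margin between syllable lengths that [no_reversal] asks for, with overlap [Ga] and errors
    [c4] and [c1]. *)
Let La := 3 * Ga + 2 * c4 + c1 + 1.
Hypotheses (la2 : La <= la 2) (la0 : la 2 + La <= la 0) (la1 : la 0 + La <= la
  1).

Let C1W : 0 <= C1. Proof. by move: C0 dl0; lra. Qed.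

Let W0 : 0 <= W. Proof. by rewrite /W; move: C1W; lra. Qed.

Let la_ge t : La <= la (t %% 3).
Proof.
have : 0 <= La by rewrite /La /c4 /c1 /c2; move: Ga0 W0 dl0 C1W; lra.
by move: la0 la1 la2;
  case: (t %% 3)%N (ltn_pmod t (isT : 0 < 3)%N) => [|[|[|]]] // _; lra.
Qed.

Let e_per (i : nat) : e (3 + i)%N = e i. Proof. by rewrite /e modnDl. Qed.

Let LC : 2 * C + 3 * dl < 2 * La.
Proof. by rewrite /La /c4 /c1 /c2 /W; move: Ga0 C0 dl0; lra. Qed.

Let P_middle n m q : (n <= m)%N -> (m <= q)%N -> E (P n) (P m) (P q) <= C1.
Proof. exact: (partial_prod_middle dl0 fp iso C0 LC (fun t => la_ge t) eC). Qed.

Let P_step t : D 1 (P t) + la (t %% 3) - C1 <= D 1 (P t.+1) <= D 1 (P t) + la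
  (t %% 3).
Proof.
have := partial_prod_growth dl0 fp iso C0 LC (fun t => la_ge t) eC t => h.
apply/andP; split; first exact: h.
apply: le_trans (mdist_via (act (P t) o) _ _) _.
by rewrite /P /= (orbit_distMr _ iso).
Qed.

Let h := P 3.

Let hE n : (h ^+ n)%g = P (n * 3).
Proof. by rewrite /h /P -(partial_prod_pow _ e_per). Qed.

Let hD n : n%:R * (la 0 + la 1 + la 2 - 3 * C1) <= D 1 (h ^+ n).
Proof.
rewrite hE; elim: n => [|n IH]; first by rewrite mul0r mdist_ge0.
have /andP[s0 _] := P_step (n * 3); have /andP[s1 _] := P_step (n * 3).+1.
have /andP[s2 _] := P_step (n * 3).+2.
rewrite modnMl in s0; rewrite -addn1 modnMDl in s1;
  rewrite -addn2 modnMDl in s2.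
rewrite (_ : (n.+1 * 3 = (n * 3).+3)%N); last by rewrite mulSn.
move: s0 s1 s2; rewrite addn1 addn2 -natr1 mulrDl mul1r (modn_small (isT : 1 <
  3)%N).
by rewrite (modn_small (isT : 2 < 3)%N); lra.
Qed.

Let sigma_le : D 1 sigma <= la 0 + la 1.
Proof.
have /andP[_] := P_step 1; have /andP[_] := P_step 0.
rewrite mdistxx (modn_small (isT : 1 < 3)%N) mod0n => h0 h1.
by apply: le_trans h1 _; rewrite lerD2r; move: h0; rewrite add0r.
Qed.

Let sigma_ge : la 0 + la 1 - C1 <= D 1 sigma.
Proof.
have /andP[+ _] := P_step 1; have := P_middle (leqnn 0) (leq0n 1).
have : D 1 (P 1) = la 0.
  by rewrite /P /= mul1g /e mod0n.
by rewrite (modn_small (isT : 1 < 3)%N) => -> _; rewrite -/sigma; lra.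
Qed.

Let long : 4 * W + 2 + 3 * dl < 2 * (D 1 sigma - W - 1).
Proof.
have := sigma_ge; move: la2 la1 la0; rewrite /La /c4 /c1 /c2.
have := W0; have := C1W; have := Ga0; have := dl0; rewrite /W; lra.
Qed.

Let forward n : exists s, cost act o sigma W o s (act (h ^+ n)%g o) <=
  n%:R * (D 1 sigma - W + la 2).
Proof.
elim: n => [|n [s IH]].
  by exists [::]; rewrite expg0 (act1 iso) /= mdistxx mul0r.
exists (s ++ [:: h ^+ n])%g.
apply: le_trans (@cost_cat_le _ _ _ act o sigma W o s (act (h ^+ n)%g o) _ _) _.
rewrite -natr1 mulrDl mul1r lerD//= mdistxx add0r lerD2l.
rewrite expgSr (orbit_distM _ iso) /h /P /= -/sigma -/(P 2) (orbit_distMr _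
  iso).
by rewrite /e (modn_small (isT : 2 < 3)%N).
Qed.

Let syllable_ends g t :
  d (act (g * P t)%g o) (act (g * P t * F (t %% 3) * zpow a 0)%g o) <= Fl /\
  d (act (g * P t.+1)%g o)
    (act (g * P t * F (t %% 3) * zpow a (N (t %% 3))%:Z)%g o) <= Fl.
Proof.
rewrite zpow0 mulg1 (orbit_distMr _ iso); split; first exact: FFl.
rewrite /P /= /e !mulgA metric_sym (orbit_distMr _ iso) (orbit_distV _ iso).
exact: FFl.
Qed.

Let syllable_nc g t :
  ~ commensurating a ((g * P t * F (t %% 3))^-1 * (g * P t.+1 * F (t.+1 %%
    3)))%g.
Proof.
have -> : ((g * P t * F (t %% 3))^-1 * (g * P t.+1 * F (t.+1 %% 3)) =
    zpow a (N (t %% 3))%:Z * ((F (t %% 3))^-1 * F (t.+1 %% 3)))%g.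
  rewrite /P /= {2}/e -/(P t) !invgM !mulgA; congr (_ * _)%g.
  by rewrite -!mulgA mulKg mulKg !mulgA mulVg mul1g.
move=> hc; apply: (Fnc (t := t)).
have := commensuratingM (commensuratingV (commensurating_pow a (N (t %%
  3))%:Z)) hc.
by rewrite !mulgA mulVg mul1g.
Qed.

(** Seen from [o], the jump would be read from its tip: a segment of length about [la 1] followed by
    one of length about [la 0], along a path whose syllables have lengths [la 0], [la 1], [la 2] in
    cyclic order. *)
Let no_jump n g : exc (act (h ^+ n)%g o) (act g o) o <= c1 ->
  exc (act (h ^+ n)%g o) (act (g * sigma)%g o) o <= c1 ->
  d (act (h ^+ n)%g o) (act g o) + D 1 sigma <=
    d (act (h ^+ n)%g o) (act (g * sigma)%g o) + c2 -> False.
Proof.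
set x := act (h ^+ n)%g o; have xE : x = act (P (n * 3)) o by rewrite /x hE.
have oE : o = act (P 0) o by rewrite /P /= (act1 iso).
rewrite ![exc x _ o]excess_sym => e0 e2 dir.
have e1 : exc o (act (g * P 1)%g o) x <= c5.
  rewrite /c5; apply: (excess_convex fp e0 e2).
  by rewrite -{1}[g]mulg1 (orbit_excM _ iso);
    exact: (P_middle (leq0n 1) (leqnSn 1)).
have c1c5 : c1 <= c5 by rewrite /c5; have := C1W; have := dl0; lra.
have C1c5 : C1 <= c5 by rewrite /c5 /c1; have := W0; have := dl0; lra.
have d01 : D g (g * P 1) = la 0.
  by rewrite (orbit_distMr _ iso) /P /= mul1g /e mod0n.
have d12 : D (g * P 1) (g * sigma) = la 1.
  by rewrite (orbit_distM _ iso) /sigma /P /= (orbit_distMr _ iso) /e.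
have v1 := mdist_via (act (g * P 1)%g o) o (act g o).
have v2 := mdist_via (act (g * sigma)%g o) o (act (g * P 1)%g o).
rewrite (metric_sym (act (g * P 1)%g o) (act g o)) d01 in v1.
rewrite (metric_sym (act (g * sigma)%g o)) d12 in v2.
have dir' : d o (act (g * sigma)%g o) + D 1 sigma <= d o (act g o) + c1 + c2.
  have := mdist_via (act g o) o x; move: e2 dir; rewrite /excess.
  by rewrite (metric_sym x (act g o)) (metric_sym x (act (g * sigma)%g o)); lra.
have sg := sigma_ge; have W0' := W0; have C1W' := C1W; have dl0' := dl0.
have oP t : d o (act (P t) o) = D 1 (P t) by rewrite (act1 iso).
have eP t : (t < n * 3)%N ->
  exc o (act (P t) o) x <= c5 /\ exc o (act (P t.+1) o) x <= c5.
  move=> tn; rewrite xE; split; apply: le_trans C1c5;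
    rewrite [X in exc X _ _]oE; apply: P_middle => //.
  exact: ltnW.
have [z0 z1] := syllable_ends g 0; have [z1' z2] := syllable_ends g 1.
rewrite mod0n in z0 z1; rewrite (modn_small (isT : 1 < 3)%N) in z1' z2.
have gP0 : (g * P 0)%g = g := mulg1 g.
rewrite {1}gP0 in z0.
have ovP t z z' k (i j : int) : (t < n * 3)%N ->
    exc o z x <= c5 -> exc o z' x <= c5 ->
    d z (act (k * zpow a i)%g o) <= Fl -> d z' (act (k * zpow a j)%g o) <= Fl ->
    d o z + Ga <= d o z' -> d o z + Ga <= D 1 (P t.+1) ->
    D 1 (P t) + Ga <= d o z' -> D 1 (P t) + Ga <= D 1 (P t.+1) ->
    commensurating a (k^-1 * (P t * F (t %% 3)))%g.
  move=> tn ez ez' kz kz'; rewrite -!oP => q1 q2 q3 q4.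
  have [et et'] := eP t tn; have [zt zt'] := syllable_ends 1%g t.
  by rewrite !mul1g in zt zt';
    exact: (over ez ez' et et' kz kz' zt zt' q1 q2 q3 q4).
(* [S1] and [S2] say that syllable t lies on the same translate of the axis as the first,
   respectively second, syllable of the jump. Adjacent syllables lie on different translates. *)
pose S1 t := commensurating a ((g * P 0 * F 0)^-1 * (P t * F (t %% 3)))%g.
pose S2 t := commensurating a ((g * P 1 * F 1)^-1 * (P t * F (t %% 3)))%g.
have nc k t : commensurating a (k^-1 * (P t * F (t %% 3)))%g ->
    ~ commensurating a (k^-1 * (P t.+1 * F (t.+1 %% 3)))%g.
  move=> ck ck'; apply: (@syllable_nc 1%g t); rewrite !mul1g.
  exact: commensurating_left ck ck'.
apply: (@no_reversal R (fun t => D 1 (P t)) la (n * 3) (d o (act g o))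
  (d o (act (g * P 1)%g o)) (d o (act (g * sigma)%g o)) Ga c4 c1 S1 S2) => //.
- by rewrite /c4 /c2 /c1; lra.
- by rewrite /c1; lra.
- by rewrite /P /= mdistxx.
- move=> t _; have /andP[p1 p2] := P_step t; apply/andP; split => //.
  by apply: le_trans p1; rewrite lerD2l lerN2 /c4 /c2 /c1; lra.
- by rewrite mdist_ge0.
- by rewrite /c4; lra.
- by rewrite /c4; lra.
- rewrite -oP -xE; move: e0; rewrite /excess; have := mdist_ge0 (act g o) x;
    lra.
- move=> t tn q1 q2 q3 q4.
  by apply: (ovP t _ _ _ _ _ tn e1 _ z1 _ q1 q2 q3 q4);
    [exact: le_trans c1c5|exact: z0].
- move=> t tn q1 q2 q3 q4.
  by apply: (ovP t _ _ _ _ _ tn _ e1 z2 _ q1 q2 q3 q4);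
    [exact: le_trans c1c5|exact: z1'].
- by move=> t; exact: nc.
- by move=> t; exact: nc.
- move=> t s1 s2; apply: (@syllable_nc g 0);
    rewrite (modn_small (isT : 1 < 3)%N) mod0n.
  exact: commensurating_right s1 s2.
Qed.

(** Forwards there is one jump per period, backwards [no_jump] leaves only the empty chain. A period
    thus contributes at least W - 3 C1 = 1; the total loss of 1 is the defect from optimality. *)
Lemma chain_qm_growth n : n%:R - 1 <= chain_qm act o sigma W (h ^+ n)%g.
Proof.
have [s hs] := forward n.
have := chain_dist_le dl0 W0 long o s (act (h ^+ n)%g o) => h1.
have [s' [s'1 s'2]] := chain_dist_opt dl0 W0 long (act (h ^+ n)%g o) o.
case: s' s'1 s'2 => [|g s'] s'1 s'2; last first.
  have [j1 j2 j3] := jump_position dl0 fp iso W0 long s'2 (mem_head g s').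
  by case: (no_jump j1 j2 j3).
rewrite /chain_qm !(act1 iso); move: s'1 => /= s'1.
have := hD n; rewrite (act1 iso) (metric_sym o) => h2.
have := sigma_le => h3.
have : n%:R * (D 1 sigma + la 2 - 3 * C1) <= n%:R * (la 0 + la 1 + la 2 - 3 *
  C1).
  by rewrite ler_wpM2l//; lra.
have -> : n%:R * (D 1 sigma + la 2 - 3 * C1) = n%:R * (D 1 sigma - W + la 2) +
  n%:R.
  by rewrite /W; ring.
by move: h1 h2 hs s'1; rewrite !(act1 iso); lra.
Qed.

Lemma exists_quasimorphism : exists f : G -> R,
  [/\ exists B, forall g1 g2, `|f (g1 * g2)%g - f g1 - f g2| <= B,
      forall g, f g^-1%g = - f g & forall n, n%:R - 1 <= f (h ^+ n)%g].
Proof.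
exists (chain_qm act o sigma W); split;
  first exact: (chain_qm_defect dl0 fp geo iso W0 long).
- exact: (chain_qmV dl0 iso W0 long).
- exact: chain_qm_growth.
Qed.

End Irreversible.

(** * Verbal lengths *)

Section VerbalSubgroup.
Variables (G : groupType) (k : nat) (w : freegroup k).
Implicit Types (x y : G) (n m : nat).

Lemma verbal_subgroup_word (v : 'I_k -> G) : verbal_subgroup w (word_eval v w).
Proof. by move=> H [_]; apply; exists v. Qed.

Lemma verbal_subgroup1 : verbal_subgroup w (1%g : G).
Proof. by move=> H [[]]; rewrite inE. Qed.

Lemma verbal_subgroupM x y :
  verbal_subgroup w x -> verbal_subgroup w y -> verbal_subgroup w (x * y)%g.
Proof.
move=> Hx Hy H HC; have gH := HC.1.
have := group_closedM gH; rewrite /mulg_closed => /(_ x y).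
by rewrite !inE; apply; [exact: Hx|exact: Hy].
Qed.

Lemma verbal_subgroupX x n : verbal_subgroup w x ->
  verbal_subgroup w (x ^+ n)%g.
Proof.
move=> Hx; elim: n => [|n IH]; first exact: verbal_subgroup1.
by rewrite expgS; apply: verbal_subgroupM.
Qed.

Lemma verbal_product1 : verbal_product w (1%g : G) 0.
Proof. by exists [tuple] => //; rewrite big_nil. Qed.

Lemma verbal_productM x y n m : verbal_product w x n -> verbal_product w y m ->
  verbal_product w (x * y)%g (n + m).
Proof.
move=> [s hs ->] [t ht ->]; exists (cat_tuple s t); last by rewrite big_cat.
by move=> z; rewrite mem_cat => /orP[/hs|/ht].
Qed.

Lemma verbal_productV x n : verbal_product w x n -> verbal_product w x^-1%g n.
Proof.
move=> [s hs ->].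
have szs : size (rev (map (fun y : G =>
  y^-1%g) s)) == n by rewrite size_rev size_map size_tuple.
exists (Tuple szs).
  move=> z /=; rewrite mem_rev => /mapP[y /hs + ->] => -[wy|[y' wy' <-]].
    by right; exists y.
  by left; rewrite invgK.
rewrite /=; elim: (tval s) => [|y t IH]; first by rewrite !big_nil invg1.
by rewrite big_cons invgM IH map_cons rev_cons -cats1 big_cat big_seq1.
Qed.

Lemma verbal_subgroup_product x :
  verbal_subgroup w x -> exists n, verbal_product w x n.
Proof.
move=> /(_ [set y | exists n, verbal_product w y n]); apply; split; last first.
  move=> y wy; exists 1%N; exists [tuple y]; last by rewrite big_seq1.
  by move=> z; rewrite inE => /eqP ->; left.
split; first by rewrite inE; exists 0%N; exact: verbal_product1.
move=> y z; rewrite !inE => -[n hn] [m hm]; exists (n + m)%N.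
by apply: verbal_productM hn (verbal_productV hm).
Qed.

(** On the verbal subgroup the default value of [xget] does not arise. *)
Lemma verbal_lengthP x :
  verbal_subgroup w x -> verbal_product w x (verbal_length w x).
Proof.
move=> /verbal_subgroup_product[n0 h0].
suff [n hn] : [set n | verbal_product w x n /\
    forall m, verbal_product w x m -> (n <= m)%N] !=set0.
  by case: (xgetI 0%N hn).
have ex : exists n, `[< verbal_product w x n >] by exists n0; apply/asboolP.
exists (ex_minn ex); case: ex_minnP => n /asboolP hn min; split => // m hm.
exact/min/asboolP.
Qed.

End VerbalSubgroup.

(** * Quasimorphisms bound the verbal length from below *)

Section Quasimorphism.
Variables (R : realType) (G : groupType) (f : G -> R) (B : R).
Hypotheses (fM : forall x y, `|f (x * y)%g - f x - f y| <= B)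
  (fV : forall x, f x^-1%g = - f x).

Lemma qm1 : f 1%g = 0.
Proof. by have := fV 1%g; rewrite invg1; lra. Qed.

Lemma qm_defect_ge0 : 0 <= B.
Proof. by apply: le_trans (fM 1%g 1%g). Qed.

Lemma qm_prod (I : eqType) (F : I -> G) (A : R) (s : seq I) :
  (forall x, x \in s -> `|f (F x)| <= A) ->
  `|f (\prod_(x <- s) F x)%g| <= (size s)%:R * (A + B).
Proof.
elim: s => [|x s IH] hs; first by rewrite big_nil qm1 normr0 mul0r.
rewrite big_cons /= -natr1 mulrDl mul1r.
have h1 := hs x (mem_head _ _).
have := fM (F x) (\prod_(y <- s) F y)%g.
have : `|f (\prod_(y <- s) F y)%g| <= (size s)%:R * (A + B).
  by apply: IH => y ys; apply: hs; rewrite inE ys orbT.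
by move: h1; rewrite !ler_norml => /andP[? ?] /andP[? ?] /andP[? ?]; lra.
Qed.

Lemma qm_word k (v : 'I_k -> G) (s : seq ('I_k * bool)) :
  `|f (\prod_(l <- s) letter_eval v l)%g -
    \sum_(l <- s) (if l.2 then - f (v l.1) else f (v l.1))| <= (size s)%:R * B.
Proof.
elim: s => [|l s IH]; first by rewrite !big_nil qm1 subr0 normr0 mul0r.
rewrite !big_cons /= -natr1 mulrDl mul1r.
have -> : (if l.2 then - f (v l.1) else f (v l.1)) = f (letter_eval v l).
  by rewrite /letter_eval; case: l.2; rewrite ?fV.
have := fM (letter_eval v l) (\prod_(y <- s) letter_eval v y)%g.
by move: IH; rewrite !ler_norml => /andP[? ?] /andP[? ?]; lra.
Qed.

(** Up to [B] per letter, [f] sends a value of [w] to the combination of the f (v i) with the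
    exponent sums as coefficients, which is 0. *)
Lemma qm_verbal k (w : freegroup k) (v : 'I_k -> G) : exponent_gcd w = 0%N ->
  `|f (word_eval v w)| <= (size w)%:R * B.
Proof.
move=> w0; have e0 i : exponent_sum w i = 0.
  apply/eqP; rewrite -absz_eq0 -dvd0n -w0 /exponent_gcd.
  by rewrite (bigD1 i)//= dvdn_gcdl.
have := qm_word v w; set S := \sum_(_ <- _) _; suff -> : S = 0 by rewrite subr0.
rewrite /S (partition_big (fun l => l.1) xpredT)//= big1// => i _.
suff -> : \sum_(l <- w | l.1 == i) (if l.2 then - f (v l.1) else f (v l.1)) =
    (exponent_sum w i)%:~R * f (v i) by rewrite e0 mul0r.
rewrite /exponent_sum rmorph_sum mulr_suml; apply: eq_bigr => l /eqP <-.
by case: l.2; rewrite ?rmorphN1 ?rmorph1 ?mulN1r ?mul1r.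
Qed.

Lemma qm_verbal_product k (w : freegroup k) x n : exponent_gcd w = 0%N ->
  verbal_product w x n -> `|f x| <= n%:R * ((size w)%:R * B + B).
Proof.
move=> w0 [s hs ->]; rewrite -[X in X%:R * _](size_tuple s).
apply: (@qm_prod _ id) => y /hs[[v _ <-]|[_ [v _ <-] <-]];
  first exact: qm_verbal.
by rewrite fV normrN; exact: qm_verbal.
Qed.

(* A quasimorphism is bounded on the verbal subset of a word with vanishing
   exponent sums, so it bounds the verbal length from below. *)
Lemma stable_verbal_length_gt0 k (w : freegroup k) g (c : R) :
  exponent_gcd w = 0%N -> verbal_subgroup w g ->
  (forall n, n%:R - c <= f (g ^+ n)%g) -> (0 < stable_verbal_length R w g)%E.
Proof.
move=> w0 wg fg; pose A := (size w)%:R * B + B + 1.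
have A0 : 0 < A.
  by rewrite /A ltr_wpDl// addr_ge0 ?mulr_ge0 ?qm_defect_ge0.
have vl n : n%:R - c <= (verbal_length w (g ^+ n)%g)%:R * A.
  apply: le_trans (fg n) _; apply: le_trans (ler_norm _) _.
  apply: le_trans (qm_verbal_product w0 (verbal_lengthP (verbal_subgroupX n
    wg))) _.
  by rewrite ler_wpM2l// /A lerDl.
(* From [N] on, n - c is at least n / 2, which gives the slope 1 / (2A). *)
pose N := (Num.bound (2 * `|c|)).+1.
have low n : (N <= n)%N ->
    ((2 * A)^-1%:E <= ((verbal_length w (g ^+ n)%g)%:R / n%:R)%:E)%E.
  move=> Nn; have n0 : 0 < n%:R :> R by rewrite ltr0n (leq_trans _ Nn).
  have cn : 2 * `|c| < n%:R.
    apply: lt_le_trans (archi_boundP _) _; first by rewrite mulr_ge0.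
    by rewrite ler_nat (leq_trans (leqnSn _) Nn).
  rewrite lee_fin ler_pdivlMr// mulrC ler_pdivrMr ?mulr_gt0//.
  by have := vl n; have := ler_norm c; lra.
apply: (@lt_le_trans _ _ (2 * A)^-1%:E);
  first by rewrite lte_fin invr_gt0 mulr_gt0.
rewrite /stable_verbal_length limn_einf_lim.
set u := (fun n => _); have /cvg_lim -> // := @cvg_einfs_sup R u.
apply: (@le_trans _ _ (einfs u N)).
  by apply: le_ereal_inf_tmp => _ [n /= Nn <-]; exact: low.
by apply: ereal_sup_ubound; exists N.
Qed.

End Quasimorphism.

(** The exponents are chosen last, for the syllables 2, 0, 1 in this order, each longer than the
    previous one by [La]; the constants in [La] were fixed without reference to them. *)
Lemma exists_linear_quasimorphism (R : realType) (G : groupType) (X :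
  metricType R)
    (dl : R) (act : G -> X -> X) (o : X) (a f : G) (K : R) :
  0 <= dl -> four_point X dl -> geodesic_space X -> isometric_action act ->
  acylindrical act -> axial act o a K -> ~ commensurating a f ->
  exists (F : nat -> G) (N : nat -> nat) (phi : G -> R),
  [/\ exists B, forall g1 g2, `|phi (g1 * g2)%g - phi g1 - phi g2| <= B,
      forall g, phi g^-1%g = - phi g &
      forall n, n%:R - 1 <= phi
        (partial_prod (fun t =>
          F (t %% 3)%N * zpow a (N (t %% 3)%N)%:Z * (F (t %% 3)%N)^-1)%g 3
          ^+ n)%g].
Proof.
move=> dl0 fp geo iso acyl axa nf.
pose F (r : nat) := (a ^+ r * f)%g.
have Fnc (r s : nat) : r != s -> ~ commensurating a ((F r)^-1 * F s)%g.
  by move=> rs; exact: (exists_translates dl0 fp iso acyl axa nf rs).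
have [C C0 hC] := @conj_diverge _ _ _ _ dl0 fp _ _ iso acyl _ _ axa _ (fun r :
  'I_3 => F r)
  (fun r s rs => Fnc _ _ rs).
pose W := 3 * (C + 2 * dl) + 1; pose c1 := 3 * W + 3 * dl + 2.
pose c5 := C + 2 * dl + c1 + dl.
pose Fl := \sum_(r < 3) mdist (act 1%g o) (act (F r) o).
have Fl_ge (r : 'I_3) : mdist (act 1%g o) (act (F r) o) <= Fl.
  by rewrite /Fl (bigD1 r)//= lerDl sumr_ge0// => s _; exact: mdist_ge0.
have c50 : 0 <= c5 by rewrite /c5 /c1 /W; lra.
have Fl0 : 0 <= Fl by rewrite /Fl sumr_ge0// => s _; exact: mdist_ge0.
have [Ga Ga0 over] := segment_overlap dl0 fp iso acyl axa c50 Fl0.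
pose La := 3 * Ga + 2 * (C + 2 * dl + c1 + (3 * W + 2 * dl + 2)) + c1 + 1.
pose len (r : nat) (n : nat) := mdist (act 1%g o) (act (F r * zpow a n%:Z * (F
  r)^-1)%g o).
have choose (r : 'I_3) (L : R) : exists n, L <= len r n.
  have [n hn] := conj_long iso axa (fun r : 'I_3 => F r) L.
  by exists n; apply: hn; rewrite absz_nat.
have [n2 h2] := choose (@Ordinal 3 2 isT) La.
have [n0 h0] := choose (@Ordinal 3 0 isT) (len 2 n2 + La).
have [n1 h1] := choose (@Ordinal 3 1 isT) (len 0 n0 + La).
pose N (r : nat) := if r is 0 then n0 else if r is 1 then n1 else n2.
exists F, N.
apply: (exists_quasimorphism dl0 fp geo iso C0 _ _ _ Ga0 over h2 h0 h1).
- move=> t; rewrite invg_conj -zpowN.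
  have := hC (Ordinal (ltn_pmod t (isT : 0 < 3)%N)) (Ordinal (ltn_pmod t.+1
    (isT : 0 < 3)%N)).
  apply.
  apply/orP; left; apply/orP; left; rewrite -val_eqE /= -[t.+1]addn1 -modnDml.
  by case: (t %% 3)%N (ltn_pmod t (isT : 0 < 3)%N) => [|[|[|]]].
- move=> t; apply: Fnc; rewrite -[t.+1]addn1 -modnDml.
  by case: (t %% 3)%N (ltn_pmod t (isT : 0 < 3)%N) => [|[|[|]]].
- by move=> t; exact: (Fl_ge (Ordinal (ltn_pmod t (isT : 0 < 3)%N))).
Qed.

Theorem theorem1p3 (R : realType) (G : groupType) (k : nat)
    (w : freegroup k) :
  acylindrically_hyperbolic R G -> (1 <= k)%N -> w <> 1%g ->
  exponent_gcd w = 0%N ->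
  exists2 g : G, verbal_subgroup w g & (0 < stable_verbal_length R w g)%E.
Proof.
move=> [X [act [hyp iso acyl nonel]]] _ w1 w0.
have [dl dl0 fp] := hyperbolic_four_point hyp; have geo := hyp.1.
have [x0 [M dir]] := nonelementary_directions dl0 fp nonel.
have e1 : x0 = act 1%g x0 by rewrite (act1 iso).
have {}dir (L : R) : exists g1 g2 g3 : G,
    [/\ L <= mdist (act 1%g x0) (act g1 x0),
      L <= mdist (act 1%g x0) (act g2 x0) &
        L <= mdist (act 1%g x0) (act g3 x0)] /\
    [/\ excess (act g1 x0) (act 1%g x0) (act g2 x0) <= M,
        excess (act g1 x0) (act 1%g x0) (act g3 x0) <= M &
        excess (act g2 x0) (act 1%g x0) (act g3 x0) <= M].
  by rewrite -e1; exact: dir.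
have [|a [K axa]] := exists_axial dl0 fp iso (o := x0) (M := M).
  by move=> L; have [g1 [g2 [_ [[L1 L2 _] [M12 _ _]]]]] := dir L; exists g1, g2.
have [f nf] := exists_noncommensurating dl0 fp iso axa dir.
have [v [v' [K' axu]]] := exists_axial_value dl0 fp iso acyl axa nf w1.
(* From here on the axis is that of a product of two values of [w], so that the syllables,
   conjugates of its powers, lie in w(G). *)
have [f' nf'] := exists_noncommensurating dl0 fp iso axu dir.
have [F [N [phi [[B phiM] phiV phin]]]] :=
  exists_linear_quasimorphism dl0 fp geo iso acyl axu nf'.
set e := (fun t => _) in phin.
suff wg : verbal_subgroup w (partial_prod e 3).
  by exists (partial_prod e 3) => //;
    exact: (stable_verbal_length_gt0 phiM phiV w0 wg phin).
have we t : verbal_subgroup w (e t).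
  rewrite /e -zpow_conj zpow_nat; apply: verbal_subgroupX.
  set g := F _; set u := (word_eval v w * _)%g.
  have -> : (g * u * g^-1 = word_eval (fun i => g * v i * g^-1) w *
      word_eval (fun i => g * v' i * g^-1) w)%g.
    by rewrite !word_eval_conj /u !mulgA mulgVK.
  by apply: verbal_subgroupM; exact: verbal_subgroup_word.
by rewrite /=; do 3![apply: verbal_subgroupM => //]; exact: verbal_subgroup1.
Qed.
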